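(* Let $\mathbf{T}$ be a complete reduced local Noetherian ring with maximal ideal $\mathfrak{m}$, and let $\mathcal{G}$ be a compact group. Let $K=\operatorname{Frac}(\mathbf{T})$ be the total ring of fractions of $\mathbf{T}$, and let $$\rho\colon \mathcal{G}\longrightarrow \operatorname{GL}_2(K)$$ be a continuous representation such that for any projection $K\to k$ onto a field, the projection of $\rho$ to a representation $\mathcal{G}\to \operatorname{GL}_2(k)$ is irreducible. Let $I\subset \mathbf{T}$ be a proper ideal. Suppose that there are two characters $\chi_1,\chi_2\colon \mathcal{G}\to \mathbf{T}^*$ such that for all $g\in\mathcal{G}$ $$\operatorname{char}(\rho(g))\equiv (x-\chi_1(g))(x-\chi_2(g)) \pmod I .$$ Then there exist a finitely generated $\mathbf{T}$-module $M$ and a surjective cohomology class $$\kappa\in H^1(\mathcal{G}, M(\chi_2^{-1}\chi_1))$$ such that $$\operatorname{Fitt}_{\mathbf{T}}(M)\subset I .$$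
   Context: $\mathbf{T}$ is complete for the $\mathfrak{m}$-adic topology. Since $\mathbf{T}$ is reduced Noetherian, $K$ is a finite product of fields; the projections $K\to k$ are those onto its field factors. Topologies are $\mathfrak{m}$-adic: $K$ carries the additive group topology in which the $\mathfrak{m}^n$ ($n\ge 0$) form a basis of open neighbourhoods of $0$, $\operatorname{GL}_2(K)\subset M_2(K)=K^4$ has the subspace topology, and finitely generated $\mathbf{T}$-modules carry the $\mathfrak{m}$-adic topology. Characters of $\mathcal{G}$ are continuous homomorphisms. $\operatorname{char}(\rho(g))\in K[x]$ is the characteristic polynomial; the congruence modulo $I$ means that its coefficients lie in $\mathbf{T}$ and are congruent modulo $I$ to those of the right-hand side. For a character $\chi\colon\mathcal{G}\to\mathbf{T}^*$, $M(\chi)$ is the $\mathbf{T}$-module $M$ with $g\in\mathcal{G}$ acting as multiplication by $\chi(g)$. $H^1(\mathcal{G},M(\chi))$ is continuous cohomology: continuous $1$-cocycles $\kappa(\sigma\tau)=\kappa(\sigma)+\chi(\sigma)\kappa(\tau)$ modulo coboundaries $\sigma\mapsto(\chi(\sigma)-1)x$, $x\in M$. A cohomology class valued in a $\mathbf{T}$-module $M$ is called surjective if the image of every cocycle representing it generates $M$ as a $\mathbf{T}$-module. $\operatorname{Fitt}_{\mathbf{T}}(M)$ is the $0$th Fitting ideal: for a presentation $\mathbf{T}^n\xrightarrow{f}\mathbf{T}^m\to M\to 0$, it is the ideal generated by all $m\times m$ minors of the matrix of $f$ (and is $0$ if $n<m$); it does not depend on the presentation. *)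

(* Defs.v *)
From HB Require Import structures.
From mathcomp Require Import all_boot all_order all_algebra.
From mathcomp Require Import boolp classical_sets functions filter topology.

Set Implicit Arguments.
Unset Strict Implicit.
Unset Printing Implicit Defensive.

Import GRing.Theory.
Local Open Scope classical_set_scope.
Local Open Scope ring_scope.

(* Possibly infinite, and not required to be Hausdorff. *)
HB.mixin Record isTopologicalGroup G of Group G & Topological G := {
  mulg_continuous : continuous (fun xy : G * G => (xy.1 * xy.2)%g) ;
  invg_continuous : continuous (fun x : G => (x^-1)%g) }.

#[short(type="topologicalGroupType")]
HB.structure Definition TopologicalGroup :=
  {G of Group G & Topological G & isTopologicalGroup G}.

Section Modules.
Variables (T : comNzRingType) (V : lmodType T).

Definition is_submodule (S : set V) : Prop :=
  [/\ S 0, forall x y, S x -> S y -> S (x + y)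
         & forall a x, S x -> S (a *: x)].

Definition submodule_span (X : set V) : set V := smallest is_submodule X.

Definition finitely_generated (S : set V) : Prop :=
  exists s : seq V, S = submodule_span [set` s].

Definition smul (J : set T) (S : set V) : set V :=
  submodule_span [set a *: x | a in J & x in S].

End Modules.

Definition is_ideal (T : comNzRingType) (J : set T) : Prop :=
  @is_submodule T T^o J.

Definition is_proper_ideal (T : comNzRingType) (J : set T) : Prop :=
  is_ideal J /\ J <> setT.

Definition noetherian (T : comNzRingType) : Prop :=
  forall J : set T, is_ideal J -> @finitely_generated T T^o J.

Definition reduced (T : comNzRingType) : Prop :=
  forall (x : T) (n : nat), x ^+ n = 0 -> x = 0.

Definition maximal_ideal (T : comNzRingType) (J : set T) : Prop :=
  is_proper_ideal J /\
  forall J' : set T, is_proper_ideal J' -> J `<=` J' -> J' = J.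

Definition local_ring (T : comNzRingType) (m : set T) : Prop :=
  maximal_ideal m /\ forall J : set T, maximal_ideal J -> J = m.

Fixpoint ideal_pow (T : comNzRingType) (m : set T) (n : nat) : set T :=
  if n is n'.+1 then @smul T T^o m (ideal_pow m n') else setT.

(* Neighbourhoods of x for the additive group topology on V in which the
   subgroups F n form a basis of neighbourhoods of 0. *)
Definition filtration_nbhs (V : zmodType) (F : nat -> set V) (x : V) :
    set_system V :=
  [set U | exists n, [set y | F n (y - x)] `<=` U].

Definition filtration_continuous (X : topologicalType) (V : zmodType)
    (F : nat -> set V) (f : X -> V) : Prop :=
  forall x : X, f @ x --> filtration_nbhs F (f x).

Definition adic (T : comNzRingType) (m : set T) (V : lmodType T) (n : nat) :
    set V :=
  smul (ideal_pow m n) setT.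

Definition adically_complete (T : comNzRingType) (m : set T) : Prop :=
  (forall x : T, (forall n, ideal_pow m n x) -> x = 0) /\
  forall u : nat -> T,
    (forall n, exists N, forall i j, (N <= i)%N -> (N <= j)%N ->
       ideal_pow m n (u i - u j)) ->
    exists l : T, u @ \oo --> filtration_nbhs (ideal_pow m) l.

(* K, through iota, is the localization of T at the nonzerodivisors of T. *)
Definition total_ring_of_fractions (T : comNzRingType) (K : comUnitRingType)
    (iota : {rmorphism T -> K}) : Prop :=
  [/\ injective iota,
      forall s : T, GRing.lreg s -> iota s \is a GRing.unit
    & forall x : K, exists a s : T, GRing.lreg s /\ x = iota a / iota s].

(* The first projection of a decomposition K = k x L; L may be the zero ring. *)
Definition field_factor (K : comUnitRingType) (k : fieldType)
    (pi : {rmorphism K -> k}) : Prop :=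
  exists (L : comPzRingType) (q : {rmorphism K -> L}),
    bijective (fun x => (pi x, q x)).

Section Representations.
Variables (G : groupType) (n : nat).

Definition is_representation (K : comUnitRingType) (rho : G -> 'M[K]_n) : Prop :=
  [/\ forall g, rho g \in unitmx, rho 1%g = 1%:M
    & forall g h, rho (g * h)%g = rho g *m rho h].

Definition irreducible_rep (k : fieldType) (rho : G -> 'M[k]_n) : Prop :=
  (0 < n)%N /\
  forall U : {vspace 'cV[k]_n},
    (forall g v, v \in U -> rho g *m v \in U) -> U = 0%VS \/ U = fullv.

End Representations.

(* Continuity for the product topology of K^(n * n), each factor having the
   group topology defined by the iota(m^i). *)
Definition continuous_representation (T : comNzRingType) (m : set T)
    (K : comUnitRingType) (iota : {rmorphism T -> K})
    (G : topologicalGroupType) (n : nat) (rho : G -> 'M[K]_n) : Prop :=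
  is_representation rho /\
  forall i j, filtration_continuous (fun e => iota @` ideal_pow m e)
                (fun g => rho g i j).

Definition adic_character (T : comUnitRingType) (m : set T)
    (G : topologicalGroupType) (chi : G -> T) : Prop :=
  [/\ forall g, chi g \is a GRing.unit, chi 1%g = 1,
      forall g h, chi (g * h)%g = chi g * chi h
    & filtration_continuous (ideal_pow m) chi].

Definition poly_congr (T : comNzRingType) (K : comUnitRingType)
    (iota : {rmorphism T -> K}) (I : set T) (p : {poly K}) (q : {poly T}) :
    Prop :=
  forall i, exists2 t : T, p`_i = iota t & I (t - q`_i).

Section Cohomology.
Variables (T : comNzRingType) (m : set T) (G : topologicalGroupType).
Variables (chi : G -> T) (M : lmodType T).

Definition cocycle (kappa : G -> M) : Prop :=
  (forall s t, kappa (s * t)%g = kappa s + chi s *: kappa t) /\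
  filtration_continuous (@adic T m M) kappa.

Definition coboundary (b : G -> M) : Prop :=
  exists x : M, forall s, b s = (chi s - 1) *: x.

(* The elements of H^1(G, M(chi)), as cosets of coboundaries in the group of
   continuous cocycles. *)
Definition H1 : set (set (G -> M)) :=
  [set c | exists2 kappa, cocycle kappa
         & c = [set kappa' | cocycle kappa' /\
                             coboundary (fun s => kappa' s - kappa s)]].

Definition surjective_class (c : set (G -> M)) : Prop :=
  forall kappa, c kappa -> submodule_span (range kappa) = setT.

End Cohomology.

Section Fitting.
Variables (T : comNzRingType) (M : lmodType T).

(* T^n --A--> T^r --p--> M --> 0 is exact; A acts on row vectors. *)
Definition is_presentation (n r : nat) (A : 'M[T]_(n, r))
    (p : {linear 'rV[T]_r -> M}) : Prop :=
  (forall x : M, exists v, p v = x) /\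
  (forall v, p v = 0 <-> exists u : 'rV[T]_n, v = u *m A).

Definition maximal_minors_ideal (n r : nat) (A : 'M[T]_(n, r)) : set T :=
  @submodule_span T T^o [set d | exists2 s : 'I_r -> 'I_n,
                         (forall i j : 'I_r, (i < j)%N -> (s i < s j)%N)
                       & d = \det (rowsub s A)].

(* All presentations give the same ideal of minors, hence the intersection is
   that common value as soon as M is finitely presented. *)
Definition Fitt : set T :=
  [set x | forall n r (A : 'M[T]_(n, r)) (p : {linear 'rV[T]_r -> M}),
             is_presentation A p -> maximal_minors_ideal A x].

End Fitting.

(* Main.v *)
Require Import Defs.
From HB Require Import structures.
From mathcomp Require Import all_boot all_order all_algebra.
From mathcomp Require Import generic_quotient ring_quotient ring.
From mathcomp Require Import boolp classical_sets functions filter topology.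

Set Implicit Arguments.
Unset Strict Implicit.
Unset Printing Implicit Defensive.

Import GRing.Theory.
Local Open Scope classical_set_scope.
Local Open Scope ring_scope.

(* Write r_g = rho(g) - chi2(g). Let P be the T-span of the r_g and Q that of
   the products (rho(g) - chi1(g)) r_h. Compactness of G makes P finitely
   generated, by r_1, ..., r_n say, and g |-> chi2(g)^-1 r_g is a cocycle with
   values in M = P / Q, presented as T^n modulo relations.

   Modulo I, rho(g) - chi1(g) is minus the adjugate r_g^* of r_g, so that a
   relation is a row A with sum_k A_k r_k = sum_kl s_kl r_k^* r_l, up to
   coefficients in I; moreover det r_k and tr(r_k^* r_l) lie in I. The heart of
   the matter is that det A is in I for n such rows. In the Clifford algebra on
   e_1, ..., e_n with e_k^2 = det r_k and e_k e_l + e_l e_k = tr(r_k^* r_l),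
   enlarged by a letter e_0 for the identity matrix, row i gives the element
   xi_i = sum_k A_ik e_k - e_0 sum_kl s_i^kl e_k e_l. Modulo I the algebra is an
   exterior algebra, and the top coefficient c of the product of the xi_i is
   det A. On the other hand the algebra acts, for each j, on spinors with
   coefficients in the exterior algebra on the letters other than j; each xi_i
   raises a weight there, and n factors exhaust the n - 1 letters, which forces
   c r_j to be scalar. As this holds for all j, irreducibility in the field
   factors of K gives c = 0.

   If chi1 and chi2 agree modulo the maximal ideal, Nakayama's lemma gives the
   surjectivity of every cocycle in the class. Otherwise chi(s0) - 1 is a unit
   for some s0, where chi = chi2^-1 chi1; one kills r_(s0) in M as well, and a
   cocycle kappa' cohomologous to a kappa with kappa(s0) = 0 takes at s0 a unit
   multiple of the vector of the coboundary. The determinants stay in I: with q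
   the singular matrix r_(s0) - l, l a root in I of the characteristic
   polynomial (Hensel), the map x |-> q x q^* turns relations into linear
   equations with coefficients in A + I. *)

(* The trivial extension R + V with V^2 = 0: the tactic [ring] in it decides
   identities between R-linear combinations in V. *)
Definition trivext (R : comNzRingType) (V : lmodType R) : Type := (R * V)%type.

Section TrivialExtension.
Variables (R : comNzRingType) (V : lmodType R).

HB.instance Definition _ := GRing.Zmodule.on (trivext V).

Definition te_mul (x y : trivext V) : trivext V :=
  (x.1 * y.1, x.1 *: y.2 + y.1 *: x.2).

Fact te_mulA : associative te_mul.
Proof.
case=> a x [b y] [c z]; rewrite /te_mul /= mulrA; congr (_, _).
by rewrite !scalerDr !scalerA -addrA mulrC (mulrC c b) (mulrC c a).
Qed.

Fact te_mulC : commutative te_mul.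
Proof. by case=> a x [b y]; rewrite /te_mul /= mulrC addrC. Qed.

Fact te_mul1 : left_id ((1, 0) : trivext V) te_mul.
Proof.
by case=> a x; rewrite /te_mul /= mul1r scale1r scaler0 addr0.
Qed.

Fact te_mulDl : left_distributive te_mul +%R.
Proof.
case=> a x [b y] [c z]; rewrite /te_mul /= mulrDl scalerDl scalerDr.
by congr (_, _) => /=; rewrite -!addrA; congr (_ + _); rewrite addrCA.
Qed.

Fact te_oner_neq0 : ((1, 0) : trivext V) != 0.
Proof. by apply/eqP => -[] /eqP; rewrite oner_eq0. Qed.

HB.instance Definition _ := GRing.Zmodule_isComNzRing.Build (trivext V)
  te_mulA te_mulC te_mul1 te_mulDl te_oner_neq0.

Definition te_up (a : R) : trivext V := (a, 0).
Definition te_in (x : V) : trivext V := (0, x).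

Fact te_up_additive : zmod_morphism te_up.
Proof. by move=> a b; rewrite /te_up; congr (_, _); rewrite subr0. Qed.
Fact te_up_multiplicative : monoid_morphism te_up.
Proof.
by split=> // a b; congr (_, _); rewrite !scaler0 addr0.
Qed.
HB.instance Definition _ := GRing.isZmodMorphism.Build R (trivext V) te_up
  te_up_additive.
HB.instance Definition _ := GRing.isMonoidMorphism.Build R (trivext V) te_up
  te_up_multiplicative.

Lemma te_in_inj : injective te_in. Proof. by move=> x y []. Qed.
Lemma te_inD x y : te_in (x + y) = te_in x + te_in y.
Proof. by congr (_, _); rewrite addr0. Qed.
Lemma te_inN x : te_in (- x) = - te_in x.
Proof. by congr (_, _); rewrite oppr0. Qed.
Lemma te_in0 : te_in 0 = 0. Proof. by []. Qed.
Lemma te_inZ a x : te_in (a *: x) = te_up a * te_in x.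
Proof. by congr (_, _) => /=; rewrite ?mulr0 // scale0r addr0. Qed.
End TrivialExtension.

Ltac lmod_ring :=
  apply: te_in_inj; rewrite !(te_inD, te_inN, te_inZ, te_in0);
  repeat match goal with |- context [te_in ?x] =>
    let v := fresh in move: (te_in x) => v end; ring.

(** * Odd operators on exterior powers *)

Section Tree.
Variable R : comNzRingType.

(* V tensored with the exterior algebra on n letters: (x, y) is x + e y, with e
   the first letter. *)
Fixpoint tree (V : lmodType R) n : lmodType R :=
  if n is n'.+1 then ((tree V n' * tree V n')%type : lmodType R) else V.

Arguments tree : simpl never.

Definition shift (A : Type) (f : nat -> A) k := f k.+1.

(* The odd operator given by F on V, by multiplication by sum_i a_i e_i and by
   the contraction with coefficients b_i. *)
Fixpoint odd_op (V : lmodType R) (F : V -> V) n :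
    (nat -> R) -> (nat -> R) -> tree V n -> tree V n :=
  if n is n'.+1 return (nat -> R) -> (nat -> R) -> tree V n -> tree V n then
    fun a b x => (odd_op F (shift a) (shift b) x.1 + b 0%N *: x.2,
                  a 0%N *: x.1 - odd_op F (shift a) (shift b) x.2)
  else fun _ _ => F.

Arguments odd_op : simpl never.

Section Ops.
Variable V : lmodType R.

Lemma tree_eta n (P : tree V n.+1 -> Type) :
  (forall x y : tree V n, P (x, y)) -> forall x, P x.
Proof. by move=> Pxy [x y]; apply: Pxy. Qed.

Lemma odd_opS (F : V -> V) n a b (x y : tree V n) :
  @odd_op V F n.+1 a b (x, y) =
  (odd_op F (shift a) (shift b) x + b 0%N *: y,
   a 0%N *: x - odd_op F (shift a) (shift b) y).
Proof. by []. Qed.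

Lemma tree_addE n (x y x' y' : tree V n) :
  (x, y) + (x', y') = (x + x', y + y') :> tree V n.+1.
Proof. by []. Qed.

Lemma tree_scaleE n c (x y : tree V n) :
  c *: ((x, y) : tree V n.+1) = (c *: x, c *: y) :> tree V n.+1.
Proof. by []. Qed.

Lemma tree_oppE n (x y : tree V n) : - (x, y) = (- x, - y) :> tree V n.+1.
Proof. by []. Qed.

Implicit Types F : {linear V -> V}.

Lemma odd_op_linear F n a b : linear (@odd_op V F n a b).
Proof.
elim: n a b => [|n IH] a b c; first exact: linearP.
elim/tree_eta=> x y; elim/tree_eta=> x' y'.
rewrite [c *: _]tree_scaleE [(_, _) + _]tree_addE !odd_opS !IH.
by rewrite [c *: (_, _)]tree_scaleE tree_addE; congr (_, _); lmod_ring.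
Qed.
HB.instance Definition _ F n a b := GRing.isLinear.Build R (tree V n) (tree V n) _
   (@odd_op V F n a b) (odd_op_linear F a b).

(** The sign in [odd_op] makes letters anticommute with one another and with [F], while a
    contraction and a multiplication pair to a scalar. So odd operators satisfy a Clifford relation
    as soon as [F] and [F'] do. *)
Lemma odd_op_anticomm F F' c n a b a' b' :
    (forall x, F (F' x) + F' (F x) = c *: x) ->
  forall x : tree V n,
  odd_op F a b (odd_op F' a' b' x) + odd_op F' a' b' (odd_op F a b x) =
  (c + \sum_(i < n) (a i * b' i + a' i * b i)) *: x.
Proof.
move=> FF'; elim: n a b a' b' => [|n IH] a b a' b' x.
  by rewrite big_ord0 addr0 /= FF'.
elim/tree_eta: x => x y; rewrite !odd_opS big_ord_recl /=.
have E u := esym (IH (shift a) (shift b) (shift a') (shift b') u).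
set S := \sum_(i < n) _; set S' := \sum_(i < n) _ in E.
rewrite -/S in E *; have -> : S = S' by [].
rewrite !(linearD, linearB, linearZ, linearN) /= [_ *: (_, _)]tree_scaleE tree_addE.
congr (_, _).
  have {}E : S' *: x = odd_op F (shift a) (shift b) (odd_op F' (shift a')
    (shift b') x) + odd_op F' (shift a') (shift b') (odd_op F (shift a) (shift
      b) x)  - c *: x by rewrite -E; lmod_ring.
  transitivity (S' *: x + (a 0%N * b' 0%N + a' 0%N * b 0%N + c) *: x);
    last by lmod_ring.
  by rewrite E; lmod_ring.
have {}E : S' *: y = odd_op F (shift a) (shift b) (odd_op F' (shift a') (shift
  b') y) + odd_op F' (shift a') (shift b') (odd_op F (shift a) (shift b) y)  -
    c *: y by rewrite -E; lmod_ring.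
transitivity (S' *: y + (a 0%N * b' 0%N + a' 0%N * b 0%N + c) *: y);
  last by lmod_ring.
by rewrite E; lmod_ring.
Qed.
End Ops.
End Tree.
Arguments tree : simpl never.
Arguments odd_op : simpl never.

Section OddOpMore.
Variables (R : comNzRingType) (V : lmodType R).

Lemma eq_odd_op (F F' : V -> V) n a a' b b' (x : tree V n) :
  F =1 F' -> a =1 a' -> b =1 b' -> odd_op F a b x = odd_op F' a' b' x.
Proof. by move=> /funext-> /funext-> /funext->. Qed.

(** [odd_op] depends linearly on the triple ([F], [a], [b]), so that a combination of Clifford
    generators is again a single odd operator. *)
Lemma odd_opDZ (F F' : V -> V) n a a' b b' c (x : tree V n) :
  odd_op F a b x + c *: odd_op F' a' b' x =
  odd_op (fun v => F v + c *: F' v) (fun m => a m + c * a' m)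
    (fun m => b m + c * b' m) x.
Proof.
elim: n a a' b b' x => [//|n IH] a a' b b'; elim/tree_eta => x y.
rewrite !odd_opS [c *: (_, _)]tree_scaleE tree_addE.
have IH' u := esym (IH (shift a) (shift a') (shift b) (shift b') u).
by rewrite {1 3}/shift in IH'; rewrite /shift !IH' ; congr (_, _); lmod_ring.
Qed.

Lemma odd_op0 n (x : tree V n) :
  odd_op (fun=> 0) (fun=> 0) (fun=> 0) x = 0.
Proof.
elim: n x => [//|n IH]; elim/tree_eta => x y; rewrite odd_opS !scale0r.
by rewrite /shift !IH subr0 addr0.
Qed.

Lemma odd_op_sum (J : Type) (s : seq J) (c : J -> R) (F : J -> V -> V) n
    (a b : J -> nat -> R) (x : tree V n) :
  \sum_(k <- s) c k *: odd_op (F k) (a k) (b k) x =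
  odd_op (fun v => \sum_(k <- s) c k *: F k v)
    (fun m => \sum_(k <- s) c k * a k m)
    (fun m => \sum_(k <- s) c k * b k m) x.
Proof.
elim: s => [|j s IH].
  by rewrite big_nil -[LHS](odd_op0 x); apply: eq_odd_op => u; rewrite big_nil.
rewrite big_cons addrC IH odd_opDZ.
by apply: eq_odd_op => u; rewrite big_cons addrC.
Qed.
End OddOpMore.

(** * Exterior degree modulo an ideal, and top coefficients *)

Section IdealFiltration.
Variables (T : comNzRingType) (I : set T).
Hypothesis idI : is_ideal I.

Lemma ideal0 : I 0. Proof. by case: idI. Qed.
Lemma idealD x y : I x -> I y -> I (x + y). Proof. by case: idI => _ + _;
  apply. Qed.
Lemma idealM a x : I x -> I (a * x). Proof. by case: idI => _ _; apply. Qed.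
Lemma idealN x : I x -> I (- x). Proof. by rewrite -mulN1r; apply: idealM. Qed.
Lemma idealB x y : I x -> I y -> I (x - y).
Proof. by move=> Ix Iy; apply: idealD => //; apply: idealN. Qed.
Lemma idealMr a x : I x -> I (x * a). Proof. by rewrite mulrC;
  apply: idealM. Qed.
Lemma ideal_sum (J : Type) (s : seq J) (P : pred J) (F : J -> T) :
  (forall j, P j -> I (F j)) -> I (\sum_(j <- s | P j) F j).
Proof. by move=> h; elim/big_ind: _; [exact: ideal0|exact: idealD|]. Qed.

(* Modulo I, only terms of exterior degree at least j occur. *)
Fixpoint deg_ge n : nat -> tree T^o n -> Prop :=
  if n is n'.+1 return nat -> tree T^o n -> Prop
  then fun j x => deg_ge j x.1 /\ deg_ge j.-1 x.2
  else fun j x => (0 < j)%N -> I x.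

Arguments deg_ge : simpl never.

Lemma deg_geZ n j c (x : tree T^o n) : deg_ge j x -> deg_ge j (c *: x).
Proof.
elim: n j x => [|n IH] j; first by move=> x h /h; apply: idealM.
by elim/tree_eta => x y [hx hy]; split; apply: IH.
Qed.

Lemma deg_geD n j (x y : tree T^o n) :
  deg_ge j x -> deg_ge j y -> deg_ge j (x + y).
Proof.
elim: n j x y => [|n IH] j.
  by move=> x y hx hy j0; apply: idealD; [exact: hx|exact: hy].
elim/tree_eta => x x'; elim/tree_eta => y y' [hx hy] [hx' hy'].
by split; apply: IH.
Qed.

Lemma deg_geN n j (x : tree T^o n) : deg_ge j x -> deg_ge j (- x).
Proof. by rewrite -scaleN1r; apply: deg_geZ. Qed.

Lemma deg_geI n j c (x : tree T^o n) : I c -> deg_ge j (c *: x).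
Proof.
move=> Ic; elim: n j x => [|n IH] j; first by move=> x _; apply: idealMr.
by elim/tree_eta => x y; split; apply: IH.
Qed.

Lemma deg_ge_zero n j : @deg_ge n j 0.
Proof. by rewrite -(scale0r 0); apply/deg_geI/ideal0. Qed.

Lemma deg_geB n j (x y : tree T^o n) :
  deg_ge j x -> deg_ge j y -> deg_ge j (x - y).
Proof. by move=> ? ?; apply: deg_geD => //; apply: deg_geN. Qed.

Lemma deg_ge_sum (J : Type) (s : seq J) (P : pred J) n j (F : J -> tree T^o n) :
  (forall k, P k -> deg_ge j (F k)) -> deg_ge j (\sum_(k <- s | P k) F k).
Proof. by move=> h; elim/big_ind: _; [exact: deg_ge_zero|exact: deg_geD|]. Qed.

Lemma deg_ge0 n (x : tree T^o n) : deg_ge 0 x.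
Proof. by elim: n x => [//|n IH]; elim/tree_eta => x y; split; apply: IH. Qed.

Lemma deg_geW n i j (x : tree T^o n) : (i <= j)%N -> deg_ge j x -> deg_ge i x.
Proof.
elim: n i j x => [|n IH] i j.
  by move=> x ij h i0; apply: h; apply: leq_trans ij.
elim/tree_eta => x y ij [hx hy]; split; first exact: IH hx.
by apply: IH hy; rewrite -!subn1 leq_sub2r.
Qed.

(** There are only [n] letters: in degree above [n] all coefficients lie in [I], and then every
    degree bound holds. *)
Lemma deg_ge_sat n i j (x : tree T^o n) : (n < i)%N -> deg_ge i x -> deg_ge j x.
Proof.
elim: n i j x => [|n IH] i j; first by move=> x i0 h _; apply: h.
elim/tree_eta => x y; case: i => // i ni [hx hy].
by split; [apply: IH hx; apply: ltnW|apply: IH hy].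
Qed.

(** Multiplication by a linear form raises the degree; the contraction has coefficients in [I], and
    multiples by [I] satisfy every degree bound. *)
Lemma odd_op_raise n j a b (x : tree T^o n) : (forall m, I (b m)) ->
  deg_ge j x -> deg_ge j.+1 (odd_op (fun=> 0) a b x).
Proof.
elim: n j a b x => [|n IH] j a b; first by move=> x _ _ _; apply: ideal0.
elim/tree_eta => x y Ib [hx hy]; rewrite odd_opS; split.
  by apply: deg_geD; [apply: IH => // m; apply: Ib|apply: deg_geI].
apply: deg_geB; first exact: deg_geZ.
(* The induction gives degree [j.-1.+1], which is [j], or 1 when [j = 0]; either suffices. *)
by apply: (@deg_geW _ _ (j.-1).+1); [case: (j)|apply: IH => // m; apply: Ib].
Qed.

Lemma odd_op_keep n j (x : tree T^o n) :
  deg_ge j x -> deg_ge j (odd_op id (fun=> 0) (fun=> 0) x).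
Proof.
elim: n j x => [//|n IH] j; elim/tree_eta => x y [hx hy]; rewrite odd_opS.
by rewrite !scale0r addr0 sub0r; split; [|apply: deg_geN]; apply: IH.
Qed.

Lemma odd_op_lower n j t (x : tree T^o n) :
  deg_ge j x -> deg_ge j.-1 (odd_op (fun=> 0) (fun=> 0) t x).
Proof.
elim: n j t x => [|n IH] j t; first by move=> x _ _; apply: ideal0.
elim/tree_eta => x y [hx hy]; rewrite odd_opS scale0r sub0r; split.
  by apply: deg_geD; [apply: IH|apply: deg_geZ].
by apply/deg_geN/IH.
Qed.

Fixpoint tree_one n : tree T^o n :=
  if n is n'.+1 return tree T^o n then (tree_one n', 0) else 1.

Fixpoint tree_top n : tree T^o n -> T :=
  if n is n'.+1 return tree T^o n -> T then fun x => tree_top x.2 else id.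
Arguments tree_top : simpl never.

Lemma tree_topS n (x y : tree T^o n) : @tree_top n.+1 (x, y) = tree_top y.
Proof. by []. Qed.

Lemma tree_topDZ n c (x y : tree T^o n) :
  tree_top (c *: x + y) = c * tree_top x + tree_top y.
Proof.
elim: n x y => [//|n IH]; elim/tree_eta => x x'; elim/tree_eta => y y'.
by rewrite [c *: (_, _)]tree_scaleE tree_addE !tree_topS IH.
Qed.

HB.instance Definition _ n :=
  GRing.isLinear.Build T (tree T^o n) T^o _ (@tree_top n) (@tree_topDZ n).

Lemma tree_topN n (x : tree T^o n) : tree_top (- x) = - tree_top x.
Proof. exact: linearN. Qed.

Lemma tree_top_deg n j (x : tree T^o n) :
  (n < j)%N -> deg_ge j x -> I (tree_top x).
Proof.
elim: n j x => [|n IH] j; first by move=> x j0; apply.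
by elim/tree_eta => x y; case: j => // j nj [_]; rewrite tree_topS; apply: IH.
Qed.

(* The exterior product of the linear forms in L. *)
Definition ext_prod n (L : seq (nat -> T)) : tree T^o n :=
  foldr (fun a => @odd_op _ T^o (fun=> 0) n a (fun=> 0)) (tree_one n) L.

Definition drop_at (A : Type) (L : seq A) i := take i L ++ drop i.+1 L.

(** In the part containing the first letter, exactly one factor [i] supplies that letter, and moving
    it to the front past [i] factors gives the sign. The top coefficient therefore follows the
    Laplace expansion of a determinant along its first column. *)
Lemma ext_prod_snd n (L : seq (nat -> T)) :
  ext_prod n.+1 L =
  (ext_prod n (map (@shift T) L),
   \sum_(i < size L) ((-1) ^+ i * nth (fun=> 0) L i 0%N) *:
      ext_prod n (map (@shift T) (drop_at L i))).
Proof.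
elim: L => [|a L IH]; first by rewrite /= big_ord0.
rewrite [LHS]/= -/(ext_prod _ _) IH odd_opS scale0r addr0; congr (_, _).
have E0 : drop_at (a :: L) 0 = L by rewrite /drop_at /= drop0.
rewrite [in RHS](big_ord_recl (size L)) expr0 mul1r E0; congr (_ + _).
rewrite -[odd_op _ _ _ _]/(odd_op (\0 : {linear T^o -> T^o}) _ _ _) linear_sum.
rewrite -sumrN; apply: eq_bigr => i _.
by rewrite linearZ /= -scaleNr exprS mulN1r mulNr.
Qed.

Lemma tree_top_ext n (L : seq (nat -> T)) : size L = n ->
  tree_top (ext_prod n L) = \det (\matrix_(i < n, k < n) nth (fun=> 0) L i k).
Proof.
elim: n L => [|n IH] L sL.
  by case: L sL => // _; rewrite det_mx00.
rewrite ext_prod_snd tree_topS linear_sum sL /= (expand_det_col _ 0).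
apply: eq_bigr => i _; rewrite linearZ /= mxE.
rewrite [X in X * _]mulrC -mulrA; congr (_ * _).
rewrite /cofactor addn0; congr (_ * _).
have sD : size (drop_at L i) = n.
  rewrite /drop_at size_cat size_drop sL size_takel ?sL ?(ltnW (ltn_ord i)) //.
  by rewrite subSS subnKC // -ltnS ltn_ord.
rewrite IH ?size_map //; congr (\det _); apply/matrixP => k l; rewrite !mxE.
rewrite (nth_map (fun=> 0)) ?sD // /shift lift0; congr (_ _).
rewrite /drop_at nth_cat size_takel ?sL ?(ltnW (ltn_ord i)) //=.
rewrite /bump; case: ltnP => ki; first by rewrite nth_take // add0n.
by rewrite nth_drop add1n addSn subnKC.
Qed.

Section Top.
Variables (n : nat) (J : Type) (A b : J -> nat -> T) (t : nat -> T).
Variable (S : J -> tree T^o n -> tree T^o n).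
Hypothesis Ib : forall i m, I (b i m).
Hypothesis tA : forall i, I (\sum_(k < n) A i k * t k).
Hypothesis S_raise : forall i j x, deg_ge j x -> deg_ge j.+2 (S i x).

Let f i := @odd_op _ T^o (fun=> 0) n (A i) (b i).
Let Pi := @odd_op _ T^o id n (fun=> 0) (fun=> 0).
Let D := @odd_op _ T^o (fun=> 0) n (fun=> 0) t.
Let u := @odd_op _ T^o id n (fun=> 0) t.

(** [u] is the action of the letter e_0: the parity operator [Pi], which keeps degrees, plus the
    contraction [D], which lowers them by one. *)
Lemma odd_op_unit x : u x = Pi x + D x.
Proof.
rewrite -[D x]scale1r odd_opDZ; apply: eq_odd_op => y /=.
- by rewrite scaler0 addr0.
- by rewrite mulr0 addr0.
- by rewrite add0r mul1r.
Qed.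

(** The operator [D \o S i] is only known to raise the degree by one, as [f i] does, so degrees
    alone do not discard it. But [D] anticommutes with [f i] up to the scalar in [tA], which lies in
    [I]; it can be moved to the far left, where it meets an element of degree above [n]. *)
Lemma tree_top_prod (s : seq J) : size s = n ->
  I (tree_top (foldr (fun i x => f i x - u (S i x)) (tree_one n) s)
     - \det (\matrix_(i < n, k < n) nth (fun=> 0) (map A s) i k)).
Proof.
have fL i : linear (f i) := odd_op_linear \0 (A i) (b i).
have DL : linear D := odd_op_linear \0 (fun=> 0) t.
pose f' i : {linear _ -> _} := HB.pack (f i) (GRing.isLinear.Build _ _ _ _ (f
  i) (fL i)).
pose D' : {linear _ -> _} := HB.pack D (GRing.isLinear.Build _ _ _ _ D DL).
have fD i x : f i (D x) = - D (f i x) + (\sum_(k < n) A i k * t k) *: x.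
  have := odd_op_anticomm (F := \0) (F' := \0) (c := 0) (A i) (b i) (fun=> 0) t _ x.
  rewrite -/(f i) -/D => h.
  suff <- : f i (D x) + D (f i x) = (\sum_(k < n) A i k * t k) *: x by lmod_ring.
  rewrite h => [|v]; last by rewrite /= scale0r addr0.
  by rewrite add0r; congr (_ *: _); apply: eq_bigr => k _; rewrite mul0r addr0.
have fA i : {morph f i : x y / x + y} := linearD (f' i).
have fB i : {morph f i : x y / x - y} := linearB (f' i).
have DB : {morph D : x y / x - y} := linearB D'.
have DN : {morph D : x / - x} := linearN D'.
have D0 : D 0 = 0 := linear0 D'.
pose X s := foldr f (tree_one n) s.
pose x s := foldr (fun i x => f i x - u (S i x)) (tree_one n) s.
(* [X s'] involves the operators [f i] alone. The degree of [y] exceeds the number of factors by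
   one, which [D] takes back, and [c] collects the terms of excess degree. *)
have main s' : exists y c, [/\ x s' = X s' + D y + c, deg_ge (size s') (X s'),
    deg_ge (size s').+1 y & deg_ge (size s').+1 c].
  elim: s' => [|i s' [y [c [xE dX dy dc]]]].
    exists 0, 0; rewrite D0 !addr0; split=> //.
    - exact: deg_ge0.
    - exact: deg_ge_zero.
    - exact: deg_ge_zero.
  have dx : deg_ge (size s') (x s').
    rewrite xE; apply: deg_geD; last exact: deg_geW dc.
    by apply: deg_geD => //; apply: odd_op_lower dy.
  have dS := S_raise i dx.
  exists (- f i y - S i (x s')), ((\sum_(k < n) A i k * t k) *: y + f i c - Pi
    (S i (x s'))).
  split.
  - rewrite /x /= -/(x s') odd_op_unit.
    rewrite {1}xE !fA fD DB DN -/(X _).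
    by lmod_ring.
  - exact: odd_op_raise.
  - apply: deg_geB => //; apply/deg_geN; exact: odd_op_raise.
  - apply: deg_geB; last exact: odd_op_keep.
    by apply: deg_geD; [apply: deg_geI|apply: odd_op_raise].
(* Modulo [I] the contractions in the [f i] vanish, which leaves the exterior product of the forms
   [A i]. *)
have extX s' : forall j, deg_ge j (X s' - ext_prod n (map A s')).
  elim: s' => [|i s' IH] j; first by rewrite subrr; apply: deg_ge_zero.
  rewrite /= -/(ext_prod _ _) -/(X _).
  have -> : f i (X s') - odd_op (fun=> 0) (A i) (fun=> 0) (ext_prod n (map A s')) =
            f i (X s' - ext_prod n (map A s')) +
            odd_op (fun=> 0) (fun=> 0) (b i) (ext_prod n (map A s')).
    have -> : odd_op (fun=> 0) (fun=> 0) (b i) (ext_prod n (map A s')) =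
       f i (ext_prod n (map A s')) - odd_op (fun=> 0) (A i) (fun=> 0) (ext_prod
         n (map A s')).
      rewrite -scaleN1r odd_opDZ; apply: eq_odd_op => y /=.
      - by rewrite scaler0 addr0.
      - by rewrite mulN1r subrr.
      - by rewrite mulr0 addr0.
    by rewrite fB; lmod_ring.
  apply: deg_geD.
    by apply: (@deg_geW _ _ j.+1) => //; apply: odd_op_raise.
  elim: (n) j (b i) (Ib i) (ext_prod _ _) => [|p IHp] j b' Ib'.
    by move=> y _; apply: ideal0.
  elim/tree_eta => y z; rewrite odd_opS scale0r sub0r; split.
    by apply: deg_geD; [apply: IHp => m; apply: Ib'|apply: deg_geI].
  by apply/deg_geN/IHp => m; apply: Ib'.
move=> ss; rewrite -(tree_top_ext (L := map A s)) ?size_map // -/(x s).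
have [y [c [-> _ dy dc]]] := main s.
rewrite ss in dy dc.
have -> : tree_top (X s + D y + c) - tree_top (ext_prod n (map A s)) =
  tree_top (X s - ext_prod n (map A s)) + tree_top (D y) + tree_top c.
  by rewrite linearB !linearD /=; ring.
apply: idealD; last exact: tree_top_deg dc.
apply: idealD; first exact: (@tree_top_deg _ n.+1).
apply: (@tree_top_deg _ n.+1) => //.
(* With [n] factors [y] has degree at least [n.+1], hence any degree, so that [D y] is still in
   degree above [n]. *)
by apply: (@odd_op_lower _ n.+2); apply: deg_ge_sat dy.
Qed.
End Top.

End IdealFiltration.
Arguments deg_ge : simpl never.
Arguments tree_top : simpl never.

(** * Adjugates of matrices of size two, and the Clifford module of the determinant form *)

Section Conj2.
Variable K : comNzRingType.
Implicit Types a b : 'M[K]_2.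

Fact conj2_key : unit. Proof. by []. Qed.
(** The adjugate, which in size two is linear; it is locked so that it opens only through
    [conj2E]. *)
Definition conj2 a := locked_with conj2_key ((\tr a)%:M - a).

Lemma conj2E a : conj2 a = (\tr a)%:M - a.
Proof. exact: locked_withE. Qed.

Lemma ord2P (i : 'I_2) : i = 0 \/ i = 1.
Proof. by case: i => [[|[|//]] Hi]; [left|right]; apply: val_inj. Qed.

Lemma mx2P a b : a 0 0 = b 0 0 -> a 0 1 = b 0 1 -> a 1 0 = b 1 0 ->
  a 1 1 = b 1 1 -> a = b.
Proof.
move=> h00 h01 h10 h11; apply/matrixP.
by move=> i j; case: (ord2P i) => ->; case: (ord2P j) => ->.
Qed.

Lemma sum2E (F : 'I_2 -> K) : \sum_(i < 2) F i = F 0 + F 1.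
Proof.
rewrite !big_ord_recl big_ord0 addr0; congr (_ + F _).
by apply: val_inj.
Qed.

Lemma mul2E a b i j : (a *m b) i j = a i 0 * b 0 j + a i 1 * b 1 j.
Proof. by rewrite mxE sum2E. Qed.

Lemma tr2E a : \tr a = a 0 0 + a 1 1.
Proof. exact: sum2E. Qed.

Lemma det2E a : \det a = a 0 0 * a 1 1 - a 0 1 * a 1 0.
Proof.
rewrite (expand_det_row a 0) sum2E /cofactor !det_mx11 !mxE /=.
have -> : lift 0 0 = 1 :> 'I_2 by apply: val_inj.
have -> : lift 1 0 = 0 :> 'I_2 by apply: val_inj.
by rewrite expr0 expr1 mul1r mulN1r mulrN.
Qed.

Lemma conj2D a b : conj2 (a + b) = conj2 a + conj2 b.
Proof. by rewrite !conj2E linearD raddfD opprD addrACA. Qed.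
Lemma conj2Z c a : conj2 (c *: a) = c *: conj2 a.
Proof. by rewrite !conj2E linearZ /= -scale_scalar_mx scalerBr. Qed.
Lemma conj2_scalar c : conj2 c%:M = c%:M.
Proof. by rewrite !conj2E mxtrace_scalar mulr2n raddfD addrK. Qed.

Definition mx2E := (mul2E, tr2E, det2E, mxE).
Ltac mx2_ring := rewrite ?conj2E; apply: mx2P; rewrite ?conj2E !mx2E /=; ring.

Lemma mul_conj2 a : a *m conj2 a = (\det a)%:M. Proof. mx2_ring. Qed.
Lemma conj2_mul a : conj2 a *m a = (\det a)%:M. Proof. mx2_ring. Qed.
Lemma mul_conj2_polar a b :
  a *m conj2 b + b *m conj2 a = (\tr (conj2 a *m b))%:M.
Proof. mx2_ring. Qed.
Lemma conj2_mul_polar a b :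
  conj2 a *m b + conj2 b *m a = (\tr (conj2 a *m b))%:M.
Proof. mx2_ring. Qed.
Lemma tr_conj2C a b : \tr (conj2 a *m b) = \tr (conj2 b *m a).
Proof. rewrite !conj2E !mx2E /=; ring. Qed.
Lemma det_sub_scalar a c : \det (a - c%:M) = c ^+ 2 - \tr a * c + \det a.
Proof. rewrite !mx2E /=; ring. Qed.
Lemma tr_conj2_sub_scalar a b c c' :
  \tr (conj2 (a - c%:M) *m (b - c'%:M)) =
  \tr (conj2 a *m b) - c' * \tr a - c * \tr b + (c * c') *+ 2.
Proof. rewrite !conj2E !mx2E /=; ring. Qed.
End Conj2.

Section Vec.
Variable K : comNzRingType.

(* The half-spin modules, with an extra factor K^2: matrices are acted on from
   the left. *)
Definition spin : lmodType K := ('M[K]_2 * 'M[K]_2)%type.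

(** Clifford multiplication by [a] for the quadratic form [\det]: it exchanges the two half-spin
    parts, and its square is [\det a]. *)
Definition vec (a : 'M[K]_2) (x : spin) : spin := (conj2 a *m x.2, a *m x.1).

Lemma vec_linear a : linear (vec a).
Proof.
move=> c [p q] [p' q']; congr (_, _) => /=; by rewrite mulmxDr -scalemxAr.
Qed.
HB.instance Definition _ a := GRing.isLinear.Build K spin spin _ (vec a)
  (vec_linear a).

Lemma vec_polar a b x :
  vec a (vec b x) + vec b (vec a x) = (\tr (conj2 a *m b)) *: x.
Proof.
case: x => p q; congr (_, _) => /=; rewrite !mulmxA -mulmxDl -mul_scalar_mx.
  by rewrite conj2_mul_polar.
by rewrite mul_conj2_polar.
Qed.

Lemma vec_sqr a x : vec a (vec a x) = \det a *: x.
Proof.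
case: x => p q; congr (_, _) => /=; rewrite mulmxA -mul_scalar_mx.
  by rewrite conj2_mul.
by rewrite mul_conj2.
Qed.
End Vec.

Section OddSqr.
Variables (R : comNzRingType) (V : lmodType R).

(** Taking both operators equal in [odd_op_anticomm] gives only twice this identity, and 2 may be a
    zero divisor. *)
Lemma odd_op_sqr (F : {linear V -> V}) c n a b : (forall x, F (F x) = c *: x) ->
  forall x : tree V n, odd_op F a b (odd_op F a b x) =
  (c + \sum_(i < n) a i * b i) *: x.
Proof.
move=> FF; elim: n a b => [|n IH] a b x.
  by rewrite big_ord0 addr0 /odd_op /= FF.
elim/tree_eta: x => x y; rewrite !odd_opS big_ord_recl /=.
rewrite !(linearD, linearB, linearZ, linearN) /= !IH [_ *: (_, _)]tree_scaleE.
by congr (_, _); lmod_ring.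
Qed.

Lemma tree_sumE n (J : Type) (s : seq J) (F G : J -> tree V n) :
  \sum_(k <- s) ((F k, G k) : tree V n.+1) =
  (\sum_(k <- s) F k, \sum_(k <- s) G k).
Proof.
elim: s => [|k s IH]; first by rewrite !big_nil.
by rewrite !big_cons IH tree_addE.
Qed.
End OddSqr.

(** * Spinors *)

Section SpinWeights.
Variables (K : comNzRingType).
Local Notation S := (spin K).

(* Second spinor components have weight 0, first ones weight 1, and each letter
   allowed by the mask adds 1; the other letters must not occur. *)
Fixpoint wt_ge n : (nat -> bool) -> nat -> tree S n -> Prop :=
  if n is n'.+1 return (nat -> bool) -> nat -> tree S n -> Prop
  then fun mask w x => wt_ge (shift mask) w x.1 /\
     if mask 0%N then wt_ge (shift mask) w.-1 x.2 else x.2 = 0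
  else fun _ w x => ((1 < w)%N -> x.1 = 0) /\ ((0 < w)%N -> x.2 = 0).
Arguments wt_ge : simpl never.

Lemma wt_geDZ n mask w c (x y : tree S n) : wt_ge mask w x -> wt_ge mask w y ->
  wt_ge mask w (c *: x + y).
Proof.
elim: n mask w x y => [|n IH] mask w.
  case=> p q [p' q'] [/= hp hq] [/= hp' hq'].
  by split=> /= w1; rewrite ?hp ?hp' ?hq ?hq' // scaler0 addr0.
elim/tree_eta=> x y; elim/tree_eta=> x' y' [/= hx hy] [/= hx' hy'].
split; first exact: IH.
by case: (mask _) hy hy'; [exact: IH|move=> -> ->; rewrite /= scaler0 addr0].
Qed.

Lemma wt_ge_zero n mask w : @wt_ge n mask w 0.
Proof.
elim: n mask w => [|n IH] mask w; first by split.
by split; [exact: IH|case: ifP => // _; exact: IH].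
Qed.

Lemma wt_geZ n mask w c (x : tree S n) : wt_ge mask w x -> wt_ge mask w (c *: x).
Proof. by move=> h; rewrite -[_ *: _]addr0; apply: wt_geDZ => //;
  apply: wt_ge_zero. Qed.
Lemma wt_geD n mask w (x y : tree S n) : wt_ge mask w x -> wt_ge mask w y ->
  wt_ge mask w (x + y).
Proof. by move=> hx hy; rewrite -[x]scale1r; apply: wt_geDZ. Qed.
Lemma wt_geB n mask w (x y : tree S n) : wt_ge mask w x -> wt_ge mask w y ->
  wt_ge mask w (x - y).
Proof. by move=> hx hy; rewrite addrC -scaleN1r; apply: wt_geDZ. Qed.
Lemma wt_geN n mask w (x : tree S n) : wt_ge mask w x -> wt_ge mask w (- x).
Proof. by rewrite -scaleN1r; apply: wt_geZ. Qed.
Lemma wt_ge_sum (J : Type) (s : seq J) n mask w (F : J -> tree S n) :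
  (forall k, wt_ge mask w (F k)) -> wt_ge mask w (\sum_(k <- s) F k).
Proof. by move=> h; elim/big_ind: _ => //; [exact: wt_ge_zero|move=> *;
  exact: wt_geD]. Qed.

Lemma wt_geW n mask w w' (x : tree S n) : (w' <= w)%N -> wt_ge mask w x ->
  wt_ge mask w' x.
Proof.
elim: n mask w w' x => [|n IH] mask w w'.
  by case=> p q ww [hp hq]; split=> h; [apply: hp|apply: hq];
    apply: leq_trans ww.
elim/tree_eta=> x y ww [hx hy]; split; first exact: IH hx.
by case: (mask _) hy => //=; apply: IH; rewrite -!subn1 leq_sub2r.
Qed.

Local Notation U := (odd_op (@vec K 1%:M) (fun=> 0) (fun=> 0)).

(** [U] removes no letter and exchanges the spinor components, whose weights differ by one. *)
Lemma wt_unit n mask w (x : tree S n) : wt_ge mask w x -> wt_ge mask w.-1 (U x).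
Proof.
elim: n mask w x => [|n IH] mask w.
  case=> p q [/= hp hq]; rewrite /odd_op /= /vec /=.
  split=> /= w1.
    by rewrite hq ?mulmx0 //; case: (w) w1.
  by rewrite hp ?mulmx0 //; case: (w) w1.
elim/tree_eta=> x y [/= hx hy]; rewrite odd_opS !scale0r addr0 sub0r.
split; first exact: IH.
case: (mask _) hy => /=; first by move=> hy; apply/wt_geN/IH.
by move=> ->; rewrite /shift linear0 oppr0.
Qed.

(** Two exchanges of components cancel, while multiplication by an allowed letter gains the weight
    that [U] may lose. *)
Lemma wt_unit_vec n mask w r a (x : tree S n) :
  (forall m, ~~ mask m -> a m = 0) -> wt_ge mask w x ->
  wt_ge mask w (U (odd_op (vec r) a (fun=> 0) x)).
Proof.
elim: n mask w a x => [|n IH] mask w a.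
  case=> p q _ [/= hp hq]; rewrite /odd_op /= /vec /=.
  by split=> /= w1; [rewrite hp|rewrite hq]; rewrite ?mulmx0.
elim/tree_eta=> x y ha [/= hx hy]; rewrite !odd_opS !scale0r !addr0 sub0r.
split; first by apply: IH => // m; apply: ha.
have a0 := ha 0%N; rewrite /= in a0.
case: (mask 0%N) hy a0 => /= [hy _|-> ->//]; last first.
  by rewrite scale0r linear0 subrr linear0 oppr0.
apply: wt_geN; rewrite linearB linearZ /=; apply: wt_geB; last first.
  by apply: IH => // m; apply: ha.
by apply: wt_geZ; apply: wt_unit.
Qed.

Section Raise.
Variables (J : Type) (s : seq J) (A : J -> K) (sg : J -> J -> K).
Variable (r : J -> 'M[K]_2).
Hypothesis rel : \sum_(k <- s) A k *: r k =
  \sum_(k <- s) \sum_(l <- s) sg k l *: (conj2 (r k) *m r l).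

(** The action on spinors of sum_k A_k e_k - e_0 sum_kl sg_kl e_k e_l, where e_k acts as [vec (r k)]
    plus multiplication by the form [a k]. *)
Definition xiK n (a : J -> nat -> K) (x : tree S n) : tree S n :=
  \sum_(k <- s) A k *: odd_op (vec (r k)) (a k) (fun=> 0) x -
  U (\sum_(k <- s) \sum_(l <- s) sg k l *:
     odd_op (vec (r k)) (a k) (fun=> 0) (odd_op (vec (r l)) (a l) (fun=> 0) x)).

(** In the part with the first letter, either [y] already carries it, or exactly one of the factors
    applied to [x] supplies it, with a sign for each odd operator that it passes. *)
Lemma xiKS n a (x y : tree S n) :
  xiK a ((x, y) : tree S n.+1) =
  (xiK (fun k => shift (a k)) x,
   (\sum_(k <- s) A k * a k 0%N) *: x +
   \sum_(k <- s) \sum_(l <- s) sg k l *: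
     (a k 0%N *: U (odd_op (vec (r l)) (shift (a l)) (fun=> 0) x)
      - a l 0%N *: U (odd_op (vec (r k)) (shift (a k)) (fun=> 0) x))
   - xiK (fun k => shift (a k)) y).
Proof.
rewrite /xiK.
under eq_bigr => k _ do rewrite odd_opS scale0r addr0 [_ *: (_, _)]tree_scaleE.
rewrite tree_sumE.
under [X in U X]eq_bigr => k _.
  under eq_bigr => l _ do
    rewrite !odd_opS !scale0r !addr0 [_ *: (_, _)]tree_scaleE.
  rewrite tree_sumE; over.
rewrite tree_sumE odd_opS tree_oppE tree_addE !scale0r addr0 sub0r.
congr (_, _); rewrite opprK /shift.
under eq_bigr => k _ do rewrite scalerBr scalerA.
rewrite sumrB -scaler_suml.
set Q1 := \sum_(k <- s) \sum_(l <- s) _;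
  set Q2 := \sum_(k <- s) \sum_(l <- s) _.
set Q3 := \sum_(k <- s) \sum_(l <- s) _.
suff -> : U Q1 = Q2 + U Q3 by lmod_ring.
suff -> : Q2 = U (Q1 - Q3) by rewrite linearB subrK.
rewrite /Q1 /Q2 /Q3 -sumrB linear_sum; apply: eq_bigr => k _.
rewrite -sumrB linear_sum; apply: eq_bigr => l _.
by rewrite !(linearB, linearZ) /=; lmod_ring.
Qed.

(** Without letters, [rel] says that the second component of the result vanishes and that the first
    depends on the second component of the argument only: the weight goes up by one. For each
    further letter [xiKS] applies: its terms in [x] keep their weight and gain the letter. *)
Lemma xiK_raise n mask w a (x : tree S n) :
  (forall k m, ~~ mask m -> a k m = 0) ->
  wt_ge mask w x -> wt_ge mask w.+1 (xiK a x).
Proof.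
elim: n mask w a x => [|n IH] mask w a.
  case=> p q _ [/= hp hq]; rewrite /xiK /odd_op /=.
  have E : \sum_(k <- s) A k *: vec (r k) (p, q) =
      ((\sum_(k <- s) A k *: conj2 (r k)) *m q, (\sum_(k <- s) A k *: r k) *m p).
    rewrite !mulmx_suml; elim: s => [|k s' IHs]; first by rewrite !big_nil.
    by rewrite !big_cons IHs; congr (_, _); rewrite /= -scalemxAl.
  have E' : \sum_(k <- s) \sum_(l <- s) sg k l *: vec (r k) (vec (r l) (p, q)) =
      ((\sum_(k <- s) \sum_(l <- s) sg k l *: (conj2 (r k) *m r l)) *m p,
       (\sum_(k <- s) \sum_(l <- s) sg k l *: (r k *m conj2 (r l))) *m q).
    elim: {1 3 5}s => [|k s' IHs]; first by rewrite !big_nil !mul0mx.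
    rewrite !big_cons IHs !mulmxDl -[LHS]/(_ + _).
    suff -> : \sum_(l <- s) sg k l *: vec (r k) (vec (r l) (p, q)) =
       ((\sum_(l <- s) sg k l *: (conj2 (r k) *m r l)) *m p,
       (\sum_(l <- s) sg k l *: (r k *m conj2 (r l))) *m q) by [].
    elim: s => [|l s1 IHl]; first by rewrite !big_nil !mul0mx.
    rewrite !big_cons IHl !mulmxDl -!scalemxAl.
    by congr (_, _); rewrite /vec /= -!mulmxA.
  rewrite E E' rel /vec /=; split=> /= w1.
    by rewrite hq ?mulmx0 ?subrr //; case: (w) w1.
  by rewrite mul1mx subrr.
elim/tree_eta=> x y ha [/= hx hy]; rewrite xiKS.
have ha' k m : ~~ shift mask m -> shift (a k) m = 0 by apply: ha.
split; first exact: IH.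
have a0 k := ha k 0%N; rewrite /=.
(* If the first letter is excluded, [y] is zero and no factor supplies that letter. *)
case: (mask 0%N) hy a0 => /= [hy _|-> a0]; last first.
  rewrite big1 => [|k _]; last by rewrite a0 ?mulr0.
  rewrite big1 => [|k _]; last first.
    by rewrite big1 // => l _; rewrite !a0 // !scale0r subrr scaler0.
  rewrite scale0r !add0r /xiK big1 => [|k _]; last first.
    by rewrite linear0 ?scaler0.
  rewrite big1 => [|k _]; first by rewrite linear0 subrr oppr0.
  by rewrite big1 // => l _; rewrite !linear0 ?scaler0.
apply: wt_geB; first apply: wt_geD.
- exact: wt_geZ.
- apply: wt_ge_sum => k; apply: wt_ge_sum => l; apply: wt_geZ.
  by apply: wt_geB; apply: wt_geZ; apply: wt_unit_vec => // m0; apply: ha'.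
- by apply: (@wt_geW _ _ w.-1.+1); [case: (w)|apply: IH].
Qed.

End Raise.
End SpinWeights.
Arguments wt_ge : simpl never.

(** * Clifford generators and their comparison with spinors *)

Definition delta (R : pzSemiRingType) (k m : nat) : R := (k == m)%:R.
Arguments delta : simpl never.

Lemma delta00 R : delta R 0 0 = 1. Proof. by []. Qed.
Lemma deltaS0 R k : delta R k.+1 0 = 0. Proof. by []. Qed.

(* The Clifford generator e_k acts by multiplication by the k-th letter and by
   this contraction; ordering the letters, e_k contracts only with those up to
   k. *)
Fixpoint clifford_contr (T : comNzRingType) (d : nat -> T) (g : nat -> nat ->
  T) k : nat -> T :=
  if k is k'.+1 then
    fun m => if m is m'.+1 then clifford_contr (shift d) (fun i j => g i.+1
      j.+1) k' m'
             else g 0%N k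
  else fun m => if m is 0%N then d 0%N else 0.

Section SpinVal.
Variables (T K : comNzRingType) (iota : {rmorphism T -> K}).
Local Notation S := (spin K).
Local Notation lift R := (odd_op (vec R) (fun=> 0) (fun=> 0)).

(* The map of Clifford modules sending 1 to (1, 1); the letters excluded by the
   mask act on spinors only. *)
Fixpoint spin_val n : (nat -> 'M[K]_2) -> (nat -> bool) -> tree T^o n -> tree S n :=
  if n is n'.+1 return (nat -> 'M[K]_2) -> (nat -> bool) -> tree T^o n -> tree S n
  then fun r mask x =>
    (spin_val (shift r) (shift mask) x.1 + lift (r 0%N) (spin_val (shift r)
      (shift mask) x.2),
     (mask 0%N)%:R *: spin_val (shift r) (shift mask) x.2)
  else fun _ _ c => ((iota c)%:M, (iota c)%:M).
Arguments spin_val : simpl never.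

Lemma spin_valS n r mask (x y : tree T^o n) :
  spin_val r mask ((x, y) : tree T^o n.+1) =
  (spin_val (shift r) (shift mask) x + lift (r 0%N) (spin_val (shift r) (shift
    mask) y),
     (mask 0%N)%:R *: spin_val (shift r) (shift mask) y).
Proof. by []. Qed.

Lemma spin_valDZ n r mask c (x y : tree T^o n) :
  spin_val r mask (c *: x + y) = iota c *: spin_val r mask x + spin_val r mask y.
Proof.
elim: n r mask x y => [|n IH] r mask.
  move=> x y; have E : (iota (c * x + y))%:M = iota c *: (iota x)%:M + (iota
    y)%:M :> 'M[K]_2.
    by rewrite rmorphD rmorphM raddfD /= scale_scalar_mx.
  by rewrite /spin_val; congr (_, _); exact: E.
elim/tree_eta=> x x'; elim/tree_eta=> y y'.
rewrite [c *: (_, _)]tree_scaleE tree_addE !spin_valS !IH.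
rewrite [iota c *: (_, _)]tree_scaleE tree_addE !(linearD, linearZ) /=.
by congr (_, _); lmod_ring.
Qed.

Lemma spin_val0 n r mask : @spin_val n r mask 0 = 0.
Proof.
by have := spin_valDZ r mask (-1) (0 : tree T^o n) 0;
   rewrite scaler0 addr0 rmorphN1 scaleN1r addNr.
Qed.
Lemma spin_valD n r mask (x y : tree T^o n) : spin_val r mask (x + y) =
  spin_val r mask x + spin_val r mask y.
Proof. by rewrite -[x]scale1r spin_valDZ rmorph1 !scale1r. Qed.
Lemma spin_valZ n r mask c (x : tree T^o n) : spin_val r mask (c *: x) = iota c
  *: spin_val r mask x.
Proof. by rewrite -[c *: x]addr0 spin_valDZ spin_val0 addr0. Qed.
Lemma spin_valN n r mask (x : tree T^o n) : spin_val r mask (- x) = - spin_val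
  r mask x.
Proof. by rewrite -scaleN1r spin_valZ rmorphN1 scaleN1r. Qed.
Lemma spin_val_sum n r mask (J : Type) (s : seq J) (F : J -> tree T^o n) :
  spin_val r mask (\sum_(k <- s) F k) = \sum_(k <- s) spin_val r mask (F k).
Proof. by apply: (big_morph _ (@spin_valD _ _ _) (@spin_val0 _ _ _)). Qed.

Lemma lift_anticomm n a b a0 (x : tree S n) :
  odd_op (vec a) a0 (fun=> 0) (lift b x) =
  - lift b (odd_op (vec a) a0 (fun=> 0) x) + (\tr (conj2 a *m b)) *: x.
Proof.
have := odd_op_anticomm a0 (fun=> 0) (fun=> 0) (fun=> 0) (vec_polar a b) x.
rewrite big1 => [|i _]; last by rewrite mulr0 mul0r addr0.
by rewrite addr0 => <-; lmod_ring.
Qed.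

Lemma lift_sqr n a (x : tree S n) : lift a (lift a x) = \det a *: x.
Proof.
rewrite (odd_op_sqr _ _ (vec_sqr a)) big1 ?addr0 // => i _; exact: mul0r.
Qed.

(** The spinor (1, 1), which is the value of 1, is fixed by [vec 1%:M]. Hence e_0 is the parity
    operator plus contractions, whose coefficients are the polar values tr r_k of e_0 and e_k. *)
Lemma spin_val_unit n r mask (t : nat -> T) (x : tree T^o n) :
  (forall k, \tr (r k) = iota (t k)) ->
  spin_val r mask (odd_op id (fun=> 0) t x) = lift 1%:M (spin_val r mask x).
Proof.
elim: n r mask t x => [|n IH] r mask t.
  by move=> x _; rewrite /spin_val /odd_op /vec /= conj2_scalar !mul1mx.
elim/tree_eta=> x y ht; rewrite odd_opS !spin_valS odd_opS !scale0r !sub0r.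
have ht' k : \tr (shift r k) = iota (shift t k) by apply: ht.
rewrite !(spin_valD, spin_valN, spin_valZ) !IH // /shift.
have := lift_anticomm 1%:M (r 0%N) (fun=> 0) (spin_val (shift r) (shift mask) y).
rewrite conj2_scalar mul1mx ht => E.
rewrite !(linearD, linearN, linearZ) /= E.
by congr (_, _); lmod_ring.
Qed.

(** Both sides obey the same Clifford relations: on the exterior algebra because of the
    contractions, on spinors because of [vec (r k)], with which the allowed letters merely
    anticommute. So e_k passes the first letter in the same way on both sides. *)
Lemma spin_val_letter n k r mask (d : nat -> T) (g : nat -> nat -> T) (x : tree
  T^o n) :
  (forall k, \det (r k) = iota (d k)) ->
  (forall k l, (k < l)%N -> \tr (conj2 (r k) *m r l) = iota (g k l)) ->
  (k < n)%N ->
  spin_val r mask (odd_op (fun=> 0) (delta T k) (clifford_contr d g k) x) =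
  odd_op (vec (r k)) (fun m => (mask m)%:R * delta K k m) (fun=> 0) (spin_val r
    mask x).
Proof.
elim: n k r mask d g x => [//|n IH] k r mask d g.
elim/tree_eta=> x y hd hg kn; rewrite odd_opS !spin_valS odd_opS.
case: k kn => [_|k kn].
  have E0 z : odd_op (fun=> 0) (shift (delta T 0)) (shift (clifford_contr d g
    0)) z = 0 :> tree T^o n.
    by rewrite -[RHS](odd_op0 z); apply: eq_odd_op.
  rewrite !E0 add0r subr0 delta00 scale1r /=.
  have E1 z : odd_op (vec (r 0)) (shift (fun m => (mask m)%:R * delta K 0 m))
    (shift (fun=> 0)) z = lift (r 0) z :> tree S n.
    by apply: eq_odd_op => // m; rewrite /shift /delta mulr0.
  rewrite !E1 !(spin_valZ, linearD, linearZ) /= lift_sqr hd delta00.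
  by congr (_, _); lmod_ring.
have -> : shift (clifford_contr d g k.+1) = clifford_contr (shift d) (fun i j
  => g i.+1 j.+1) k by [].
rewrite !deltaS0.
have -> : shift (delta T k.+1) = delta T k by [].
have -> : shift (fun m => (mask m)%:R * delta K k.+1 m) = fun m => (mask
  m.+1)%:R * delta K k m by [].
have IH' z := IH k (shift r) (shift mask) (shift d) (fun i j => g i.+1 j.+1) z
  (fun _ => hd _) _ kn.
rewrite !(spin_valD, spin_valN, spin_valZ) !IH' ?rmorph0; try by move=> *;
  apply: hg.
have := lift_anticomm (r k.+1) (r 0%N) (fun m => (mask m.+1)%:R * delta K k m)
  (spin_val (shift r) (shift mask) y).
have -> : \tr (conj2 (r k.+1) *m r 0%N) = iota (g 0%N k.+1).
  by rewrite tr_conj2C hg.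
move=> E; rewrite mulr0 !(linearD, linearN, linearZ) /= E /shift.
by congr (_, _); lmod_ring.
Qed.

(** The product of all [n] letters with a second spinor component has weight [n], so it cannot occur
    in weight [w]. Its coefficient is the top coefficient of [x] plus, up to sign, that of [y] times
    [a]. *)
Lemma wt_val_top n (r : nat -> 'M[K]_2) (mask : nat -> bool) w (x y : tree T^o
  n) a : (forall m, mask m) -> (n < w)%N ->
  wt_ge mask w (spin_val r mask x + lift a (spin_val r mask y)) ->
  exists b : bool, (iota (tree_top x))%:M = (-1) ^+ b *: (iota (tree_top y) *: a).
Proof.
elim: n r mask w x y => [|n IH] r mask w.
  move=> x y hm w0 [/= _ /(_ w0)]; rewrite /odd_op /vec /=.
  move/eqP; rewrite addr_eq0 => /eqP E; exists true.
  by rewrite [LHS]E scaleN1r mul_mx_scalar.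
elim/tree_eta=> x x'; elim/tree_eta=> y y' hm; case: w => // w nw [_].
rewrite !spin_valS odd_opS !scale0r addr0 sub0r hm !scale1r -linearN -spin_valN => h.
have [b E] := IH (shift r) (shift mask) w x' (- y') (fun m => hm m.+1) nw h.
by exists (~~ b); rewrite !tree_topS E tree_topN rmorphN scaleNr -scalerN;
  case: b {E}; rewrite /= ?expr0 ?expr1 ?scale1r ?scaleN1r ?scalerN ?opprK.
Qed.

(** The letters before [j] are stripped, which lowers [n] and [w] together. The excluded letter [j]
    acts through [vec (r j)] alone, and [wt_val_top] applies to the letters after it, which are
    fewer than the remaining weight. *)
Lemma spin_val_top_scalar n j (r : nat -> 'M[K]_2) w (x : tree T^o n) : (j <
  n)%N -> (n <= w)%N ->
  wt_ge (fun m => m != j) w (spin_val r (fun m => m != j) x) ->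
  exists c : K, c%:M = iota (tree_top x) *: r j.
Proof.
elim: n j r w x => [//|n IH] j r w; elim/tree_eta=> x y jn nw;
  rewrite spin_valS tree_topS.
case: j jn => [_|j jn] [h1 h2].
  have [//|b E] := wt_val_top (mask := shift (fun m => m != 0%N)) _ nw h1.
  exists ((-1) ^+ b * iota (tree_top x)).
  by rewrite -scale_scalar_mx E scalerA -signr_addb addbb scale1r.
move: h2; rewrite /= scale1r => h2.
have : wt_ge (fun m => m != j) w.-1 (spin_val (shift r) (fun m => m != j) y) by
  exact: h2.
by apply: (IH j (shift r)) => //; case: (w) nw.
Qed.
End SpinVal.

Arguments spin_val : simpl never.

(** * The determinant of a system of relations *)

Section CliffordTop.
Variables (T K : comNzRingType) (I : set T) (iota : {rmorphism T -> K}).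
Variables (n : nat) (r : nat -> 'M[K]_2).
Variables (d t : nat -> T) (g : nat -> nat -> T).
Variables (A : 'I_n -> 'I_n -> T) (s : 'I_n -> 'I_n -> 'I_n -> T).
Hypotheses (idI : is_ideal I) (iota_inj : injective iota).
Hypothesis Id : forall k, I (d k).
Hypothesis Ig : forall k l, I (g k l).
Hypothesis hd : forall k, \det (r k) = iota (d k).
Hypothesis ht : forall k, \tr (r k) = iota (t k).
Hypothesis hg : forall k l, \tr (conj2 (r k) *m r l) = iota (g k l).
Hypothesis rel : forall i, \sum_k iota (A i k) *: r k =
  \sum_k \sum_l iota (s i k l) *: (conj2 (r k) *m r l).

Let A' i m := \sum_(k < n) A i k * delta T k m.
Let B i m := \sum_(k < n) A i k * clifford_contr d g k m.
Let e n k := @odd_op _ T^o (fun=> 0) n (delta T k) (clifford_contr d g k).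
Let f i := @odd_op _ T^o (fun=> 0) n (A' i) (B i).
Let S i (x : tree T^o n) := \sum_(k < n) \sum_(l < n) s i k l *: e k (e l x).
Let P := foldr (fun i x => f i x - odd_op id (fun=> 0) t (S i x)) (tree_one T
  n) (enum 'I_n).

Lemma clifford_contr_ideal k m : I (clifford_contr d g k m).
Proof.
elim: k d g Id Ig m => [|k IH] d' g' Id' Ig' [|m] /=.
- exact: Id'.
- exact: ideal0.
- exact: Ig'.
- by apply: IH => *; [apply: Id'|apply: Ig'].
Qed.

Lemma A'E i (k : 'I_n) : A' i k = A i k.
Proof.
rewrite /A' (bigD1 k) //= big1 ?addr0 => [|l lk].
  by rewrite /delta eqxx mulr1.
by rewrite /delta (inj_eq val_inj) (negPf lk) mulr0.
Qed.

Lemma clifford_top_det : I (tree_top P - \det (\matrix_(i, k) A i k)).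
Proof.
have -> : \matrix_(i, k) A i k =
    \matrix_(i < n, k < n) nth (fun=> 0) (map A' (enum 'I_n)) i k.
  apply/matrixP => i k; rewrite !mxE (nth_map i) ?size_enum_ord //.
  by rewrite nth_ord_enum A'E.
apply: tree_top_prod => //.
- by move=> i m; apply: ideal_sum => // k _; apply: idealM => //;
    apply: clifford_contr_ideal.
(* Taking the trace of the [i]-th relation expresses this sum through the polar values [g k l],
   which lie in [I]. *)
- move=> i; have -> : \sum_(k < n) A' i k * t k =
      \sum_k \sum_l s i k l * g k l.
    apply: iota_inj; under eq_bigr => k _ do rewrite A'E.
    transitivity (\tr (\sum_k iota (A i k) *: r k)).
      rewrite linear_sum rmorph_sum; apply: eq_bigr => k _.
      by rewrite linearZ /= ht rmorphM.
    rewrite rel linear_sum rmorph_sum; apply: eq_bigr => k _.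
    rewrite linear_sum rmorph_sum; apply: eq_bigr => l _.
    by rewrite linearZ /= hg rmorphM.
  by apply: ideal_sum => // k _; apply: ideal_sum => // l _; apply: idealM.
- move=> i j x dx; apply: deg_ge_sum => // k _; apply: deg_ge_sum => // l _.
  apply: deg_geZ => //; apply: (odd_op_raise idI _ (clifford_contr_ideal k)).
  exact: (odd_op_raise idI _ (clifford_contr_ideal l)).
- by rewrite size_enum_ord.
Qed.

(** [spin_val], with the mask that excludes [j], carries each of the [n] factors to an operator
    [xiK], which raises the weight by one; the product thus reaches weight [n]. *)
Lemma clifford_top_scalar j : (j < n)%N -> exists c : K, c%:M = iota (tree_top
  P) *: r j.
Proof.
move=> jn; apply: (spin_val_top_scalar (w := n)) => //.
set mask := fun m => m != j.
pose a (k : 'I_n) m := (mask m)%:R * delta K k m.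
have eE k (x : tree T^o n) : (k < n)%N -> spin_val iota r mask (e k x) =
    odd_op (vec (r k)) (fun m => (mask m)%:R * delta K k m) (fun=> 0) (spin_val
      iota r mask x).
  by move=> kn; apply: spin_val_letter => //.
have xiE i (x : tree T^o n) :
    spin_val iota r mask (f i x - odd_op id (fun=> 0) t (S i x)) =
    xiK (index_enum 'I_n) (fun k => iota (A i k)) (fun k l => iota (s i k l))
      (fun k => r k) a (spin_val iota r mask x).
  rewrite spin_valD spin_valN (spin_val_unit _ _ ht) /xiK;
    congr (_ - odd_op _ _ _ _).
    have -> : f i x = \sum_k A i k *: e k x.
      rewrite odd_op_sum; apply: eq_odd_op => // y.
      by rewrite big1 // => k _; rewrite scaler0.
    rewrite spin_val_sum; apply: eq_bigr => k _; by rewrite spin_valZ eE.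
  rewrite spin_val_sum; apply: eq_bigr => k _; rewrite spin_val_sum;
    apply: eq_bigr => l _.
  by rewrite spin_valZ !eE.
suff H q : wt_ge mask (size q) (spin_val iota r mask
    (foldr (fun i x => f i x - odd_op id (fun=> 0) t (S i x)) (tree_one T n) q)).
  by have := H (enum 'I_n); rewrite size_enum_ord.
elim: q => [|i q IH] /=.
  elim: (n) (r) (mask) => [|p IHp] r' mask' //; split; last first.
    by rewrite /= spin_val0 scaler0; case: ifP => // _; apply: wt_ge_zero.
  by rewrite /= spin_val0 linear0 addr0; apply: IHp.
rewrite xiE; apply: xiK_raise => //.
by move=> k m /negPf; rewrite /a => ->; rewrite mul0r.
Qed.

(** The same [c] serves all [j], because the product is formed before a mask is chosen. *)
Theorem relation_det_scalar : exists c : T, I (c - \det (\matrix_(i, k) A i k)) /\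
  forall j, (j < n)%N -> exists a : K, a%:M = iota c *: r j.
Proof. by exists (tree_top P); split;
  [exact: clifford_top_det|exact: clifford_top_scalar]. Qed.
End CliffordTop.

(** * Noetherian modules *)

Section Submodules.
Variables (T : comNzRingType) (V : lmodType T).
Implicit Types (S N : set V) (X : set V).

Lemma sub0 S : is_submodule S -> S 0. Proof. by case. Qed.
Lemma subD S x y : is_submodule S -> S x -> S y -> S (x + y).
Proof. by case=> _ + _; apply. Qed.
Lemma subZ S a x : is_submodule S -> S x -> S (a *: x).
Proof. by case=> _ _; apply. Qed.
Lemma subN S x : is_submodule S -> S x -> S (- x).
Proof. by rewrite -scaleN1r; apply: subZ. Qed.
Lemma subB S x y : is_submodule S -> S x -> S y -> S (x - y).
Proof. by move=> hS hx hy; apply: subD => //; apply: subN. Qed.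
Lemma sub_sum S (J : Type) (s : seq J) (P : pred J) (F : J -> V) :
  is_submodule S -> (forall j, P j -> S (F j)) -> S (\sum_(j <- s | P j) F j).
Proof.
by move=> hS h; elim/big_ind: _; [exact: sub0|move=> x y; exact: subD|].
Qed.

Lemma span_submodule X : is_submodule (submodule_span X).
Proof.
split=> [S [hS _]|x y hx hy S [hS XS]|a x hx S [hS XS]].
- exact: sub0.
- by apply: subD => //; [apply: hx|apply: hy].
- by apply: subZ => //; apply: hx.
Qed.

Lemma sub_span X : X `<=` submodule_span X.
Proof. exact: sub_smallest. Qed.

Lemma span_min X S : is_submodule S -> X `<=` S -> submodule_span X `<=` S.
Proof. by move=> hS XS; apply: smallest_sub. Qed.

Lemma span_mono X Y : X `<=` Y -> submodule_span X `<=` submodule_span Y.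
Proof.
by move=> XY; apply: span_min; [exact: span_submodule|apply: (subset_trans XY);
  exact: sub_span].
Qed.

Lemma span_seqP (s : seq V) (x : V) :
  submodule_span [set` s] x <-> exists c : nat -> T, x = \sum_(i < size s) c i
    *: s`_i.
Proof.
split=> [|[c ->]]; last first.
  apply: sub_sum => [|i _]; first exact: span_submodule.
  by apply: (subZ _ (span_submodule _)); apply: sub_span; rewrite /= mem_nth.
move: x; apply: (span_min (S := [set x | exists c : nat -> T, x = \sum_(i <
  size s) c i *: s`_i])); last first.
  move=> x /= xs; exists (fun i => (i == index x s)%:R).
  have xs' : (index x s < size s)%N by rewrite index_mem.
  rewrite (bigD1 (Ordinal xs')) //= eqxx scale1r nth_index // big1 ?addr0 // => i.
  by rewrite -(inj_eq val_inj) /= => /negPf->; rewrite scale0r.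
split.
- by exists (fun=> 0); rewrite big1 // => i _; rewrite scale0r.
- move=> _ _ [c ->] [c' ->]; exists (fun i => c i + c' i).
  by rewrite -big_split; apply: eq_bigr => i _; rewrite scalerDl.
- move=> a _ [c ->]; exists (fun i => a * c i).
  by rewrite scaler_sumr; apply: eq_bigr => i _; rewrite scalerA.
Qed.

Lemma is_submoduleI S N : is_submodule S -> is_submodule N -> is_submodule (S `&` N).
Proof.
move=> hS hN; split; first by split; exact: sub0.
  by move=> x y [Sx Nx] [Sy Ny]; split; apply: subD.
by move=> a x [Sx Nx]; split; apply: subZ.
Qed.

Lemma is_submoduleT : is_submodule [set: V].
Proof. by []. Qed.

Definition noeth_mod := forall S, is_submodule S -> finitely_generated S.

Definition sum_sub S N : set V := [set x | exists2 y, S y & N (x - y)].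

Lemma sum_sub_submodule S N : is_submodule S -> is_submodule N ->
  is_submodule (sum_sub S N).
Proof.
move=> hS hN; split.
- by exists 0; [exact: sub0|rewrite subr0; exact: sub0].
- move=> x y [x' Sx Nx] [y' Sy Ny]; exists (x' + y'); first exact: subD.
  by rewrite opprD addrACA; apply: subD.
- move=> a x [x' Sx Nx]; exists (a *: x'); first exact: subZ.
  by rewrite -scalerBr; apply: subZ.
Qed.
End Submodules.

Section LinearMaps.
Variables (T : comNzRingType) (V W : lmodType T) (f : {linear V -> W}).

Lemma image_submodule (S : set V) : is_submodule S -> is_submodule (f @` S).
Proof.
move=> hS; split; first by exists 0; [exact: sub0|rewrite linear0].
  move=> _ _ [x Sx <-] [y Sy <-]; exists (x + y); first exact: subD.
  by rewrite linearD.
by move=> a _ [x Sx <-]; exists (a *: x); [exact: subZ|rewrite linearZ].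
Qed.

Lemma preimage_submodule (S : set W) : is_submodule S -> is_submodule (f @^-1` S).
Proof.
move=> hS; split=> [|x y|a x]; rewrite /= ?linear0 ?linearD ?linearZ.
- exact: sub0.
- exact: subD.
- exact: subZ.
Qed.

Lemma image_span (X : set V) :
  f @` submodule_span X = submodule_span (f @` X).
Proof.
apply/seteqP; split; last first.
  apply: span_min; first exact/image_submodule/span_submodule.
  by apply: image_subset; apply: sub_span.
move=> _ [x hx <-]; move: x hx.
apply: (span_min (S := f @^-1` (submodule_span (f @` X))));
  first exact/preimage_submodule/span_submodule.
by move=> x Xx; apply: sub_span; exists x.
Qed.

(** Lifts of generators of the image, together with generators of the kernel, generate [S]. *)
Lemma fg_extension (S : set V) : is_submodule S ->
  finitely_generated (f @` S) -> finitely_generated (S `&` [set x | f x = 0]) ->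
  finitely_generated S.
Proof.
move=> hS [s sE] [t tE].
have [s' s's sS] : exists2 s' : seq V, [seq f x | x <- s'] = s & forall x, x
  \in s' -> S x.
  have : forall y, y \in s -> (f @` S) y by move=> y ys; rewrite sE;
    apply: sub_span.
  elim: s {sE} => [|y s IH] h; first by exists [::].
  have [x|s' <- s'S] := IH; first by move=> xs; apply: h; rewrite inE xs orbT.
  have [|x Sx <-] := h y; first by rewrite inE eqxx.
  by exists (x :: s') => // z; rewrite inE => /orP[/eqP->//|]; apply: s'S.
exists (s' ++ t); apply/seteqP; split; last first.
  apply: span_min => // x /=; rewrite mem_cat => /orP[/sS//|xt].
  by have [] : (S `&` [set x | f x = 0]) x by rewrite tE; apply: sub_span.
move=> x Sx; have : (f @` S) (f x) by exists x.
rewrite sE -s's.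
have -> : [set` [seq f x | x <- s']] = f @` [set` s'].
  by apply/seteqP; split=> y /=; [move/mapP => [z zs ->];
    exists z|move=> [z zs <-]; apply: map_f].
rewrite -image_span => -[z hz fz].
have hz' : submodule_span [set` s' ++ t] z.
  by apply: (span_mono _ hz) => y /= ys; rewrite mem_cat ys.
have : (S `&` [set x | f x = 0]) (x - z).
  split; last by rewrite /= linearB fz subrr.
  by apply: subB => //; exact: (span_min hS sS hz).
rewrite tE => ht; rewrite -(subrK z x); apply: (subD (span_submodule _)) => //.
by apply: (span_mono _ ht) => y /= yt; rewrite mem_cat yt orbT.
Qed.
End LinearMaps.

Section Noetherian.
Variables (T : comNzRingType).
Hypothesis T_noeth : noetherian T.

(** Induction on the list: the image under the first functional is an ideal, and the other
    functionals separate the points of the kernel. *)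
Lemma noeth_functionals (V : lmodType T) (J : eqType) (L : seq J)
    (f : J -> {linear V -> T^o}) (S : set V) : is_submodule S ->
  (forall x, S x -> (forall j, j \in L -> f j x = 0) -> x = 0) ->
    finitely_generated S.
Proof.
elim: L S => [|l L IH] S hS h.
  exists [::]; apply/seteqP; split=> x.
    by move=> Sx; rewrite (h x) //; apply: sub0; exact: span_submodule.
  by apply: (span_min hS) => // y.
apply: (fg_extension (f := f l)) => //.
  exact/T_noeth/image_submodule.
apply: IH => [|x [Sx lx] hx].
  apply: is_submoduleI => //; split; first by rewrite /= linear0.
    by move=> x y /= hx hy; rewrite linearD hx hy addr0.
  by move=> a x /= hx; rewrite linearZ /= hx scaler0.
by apply: h => // l'; rewrite inE => /orP[/eqP->|/hx].
Qed.

Definition mx_entry m n i j : 'M[T]_(m, n) -> T^o := fun A => A i j.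
Lemma mx_entry_linear m n i j : linear (@mx_entry m n i j).
Proof. by move=> a A B; rewrite /mx_entry !mxE. Qed.
HB.instance Definition _ m n i j :=
  GRing.isLinear.Build T 'M[T]_(m, n) T^o _ (@mx_entry m n i j)
    (@mx_entry_linear m n i j).

Lemma noeth_matrix m n : noeth_mod 'M[T]_(m, n).
Proof.
move=> S hS; pose F (ij : 'I_m * 'I_n) : {linear 'M[T]_(m, n) -> T^o} :=
  mx_entry ij.1 ij.2.
apply: (noeth_functionals (f := F) (L := enum {: 'I_m * 'I_n})) => //.
move=> A _ h; apply/matrixP => i j; rewrite mxE; apply: (h (i, j)).
by rewrite mem_enum.
Qed.

End Noetherian.

(** * Quotient modules *)

Section QuotientModule.
Local Open Scope quotient_scope.
Variables (T : comNzRingType) (V : lmodType T) (N : set V).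
Hypothesis hN : is_submodule N.

Definition mod_pred : pred V := fun x => `[< N x >].
Fact mod_pred_closed : zmod_closed mod_pred.
Proof.
have E x : (x \in mod_pred) = `[< N x >] by [].
split=> [|x y]; rewrite !E; first by apply/asboolP; exact: sub0.
by move=> /asboolP Nx /asboolP Ny; apply/asboolP; exact: subB.
Qed.
Definition mod_closed : zmodClosed V :=
  HB.pack mod_pred (GRing.isZmodClosed.Build V mod_pred mod_pred_closed).

Definition qmod := Quotient.quot mod_closed.
HB.instance Definition _ := GRing.Zmodule.on qmod.
Definition qpi (x : V) : qmod := \pi_(Quotient.quot mod_closed) x.

Lemma qpi_eq x y : qpi x = qpi y <-> N (x - y).
Proof.
split; last by move=> Nxy; apply/eqP; rewrite -Quotient.idealrBE; apply/asboolP.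
by move/eqP; rewrite -Quotient.idealrBE => /asboolP.
Qed.

Lemma qpi_surj (y : qmod) : exists x, qpi x = y.
Proof. by exists (repr y); rewrite /qpi reprK. Qed.

Lemma qpiD : {morph qpi : x y / x + y}.
Proof. exact: raddfD. Qed.

Definition qscale (a : T) (y : qmod) : qmod := qpi (a *: repr y).
Lemma qscaleE a x : qscale a (qpi x) = qpi (a *: x).
Proof.
apply/qpi_eq; rewrite -scalerBr; apply: subZ => //.
by apply/qpi_eq; rewrite /qpi reprK.
Qed.

Fact qscaleA a b v : qscale a (qscale b v) = qscale (a * b) v.
Proof. by have [x <-] := qpi_surj v; rewrite !qscaleE scalerA. Qed.
Fact qscale1 : left_id 1 qscale.
Proof. by move=> v; have [x <-] := qpi_surj v; rewrite !qscaleE scale1r. Qed.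
Fact qscaleDr : right_distributive qscale +%R.
Proof.
move=> a v w; have [x <-] := qpi_surj v; have [y <-] := qpi_surj w.
by rewrite -qpiD !qscaleE scalerDr qpiD.
Qed.
Fact qscaleDl v : {morph qscale^~ v : a b / a + b}.
Proof. by move=> a b /=; have [x <-] := qpi_surj v;
  rewrite !qscaleE scalerDl qpiD. Qed.

HB.instance Definition _ := GRing.Zmodule_isLmodule.Build T qmod
  qscaleA qscale1 qscaleDr qscaleDl.

Fact qpi_linear : linear qpi.
Proof. by move=> a x y; rewrite qpiD -qscaleE. Qed.
HB.instance Definition _ := GRing.isLinear.Build T V qmod _ qpi qpi_linear.
End QuotientModule.

Lemma quotient_module (T : comNzRingType) (V : lmodType T) (N : set V) :
  is_submodule N -> exists (M : lmodType T) (p : {linear V -> M}),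
    (forall y, exists x, p x = y) /\ forall x, p x = 0 <-> N x.
Proof.
move=> hN; exists (qmod hN), (qpi hN : {linear _ -> _}); split;
  first exact: qpi_surj.
by move=> x; rewrite -[0](linear0 (qpi hN)) qpi_eq subr0.
Qed.

(** * The maximal condition on submodules *)

Section NoethMax.
Variables (T : comNzRingType) (V : lmodType T).
Hypothesis hV : noeth_mod V.

Lemma noeth_max (F : set (set V)) : F !=set0 ->
  (forall S, F S -> is_submodule S) ->
  exists2 S, F S & forall S', F S' -> S `<=` S' -> S' `<=` S.
Proof.
move=> [S0 FS0] hF; pose P (A : set V) := A = set0 \/ F A.
have [C CP tC|A [PA maxA]] := @Zorn_bigcup V P.
  have [[X CX FX]|noF] := pselect (exists2 X, C X & F X); last first.
    left; rewrite -subset0 => x [X CX Xx].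
    by have [X0|FX] := CP _ CX; [rewrite -X0|case: noF; exists X].
  right.
  (* The finitely many generators of the union lie in one member of the chain, which is therefore
     the union. *)
  have [s sE] : finitely_generated (\bigcup_(X in C) X).
    apply: hV; split.
    - by exists X => //; exact: sub0 (hF _ FX).
    - move=> x y [X1 C1 x1] [X2 C2 x2].
      wlog X12 : X1 X2 C1 C2 x y x1 x2 / X1 `<=` X2.
        move=> W; have [X12|X21] := tC _ _ C1 C2; first exact: (W X1 X2).
        by rewrite addrC; apply: (W X2 X1).
      exists X2 => //; apply: subD => //; last exact: X12.
      by have [X0|/hF//] := CP _ C2; move: x2; rewrite X0.
    - move=> a x [X1 C1 x1]; exists X1 => //; apply: subZ => //.
      by have [X0|/hF//] := CP _ C1; move: x1; rewrite X0.
  suff [Y [CY FY sY]] : exists Y, [/\ C Y, F Y & [set` s] `<=` Y].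
    suff -> : \bigcup_(X in C) X = Y by [].
    apply/seteqP; split; last by move=> y Yy; exists Y.
    by rewrite sE; apply: span_min => //; apply: hF.
  have : [set` s] `<=` \bigcup_(X in C) X by rewrite sE; apply: sub_span.
  elim: s {sE} => [|x s IH] h; first by exists X; split.
  have [y ys|Y [CY FY sY]] := IH; first by apply: h; rewrite /= inE ys orbT.
  have [|Z CZ Zx] := h x; first by rewrite /= inE eqxx.
  have FZ : F Z by have [Z0|//] := CP _ CZ; move: Zx; rewrite Z0.
  have [ZY|YZ] := tC _ _ CZ CY.
    exists Y; split=> // y /=; rewrite inE => /orP[/eqP->|];
      [exact: ZY|exact: sY].
  exists Z; split=> // y /=; rewrite inE => /orP[/eqP->//|ys]; exact/YZ/sY.
have FA : F A.
  case: PA => // A0; exfalso; apply: (maxA S0); last by right.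
  split; first by rewrite A0; apply: sub0set.
  by move=> /(_ 0 (sub0 (hF _ FS0))); rewrite A0.
exists A => // S' FS' AS'; apply: contrapT => nS'A.
by apply: (maxA S'); [split|right].
Qed.
End NoethMax.

(** * Powers of an ideal and adic filtrations *)

Section IdealPow.
Variables (T : comNzRingType) (m : set T).
Hypothesis idm : is_ideal m.
Implicit Types V W : lmodType T.

Lemma smul_submodule V (J : set T) (S : set V) : is_submodule (smul J S).
Proof. exact: span_submodule. Qed.

Lemma smulP V (J : set T) (S : set V) a x : J a -> S x -> smul J S (a *: x).
Proof. by move=> Ja Sx; apply: sub_span; exists a => //; exists x. Qed.

Lemma smul_min V (J : set T) (S S' : set V) : is_submodule S' ->
  (forall a x, J a -> S x -> S' (a *: x)) -> smul J S `<=` S'.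
Proof. by move=> hS' h; apply: span_min => // _ [a Ja [x Sx <-]]; apply: h. Qed.

Lemma ideal_pow_ideal n : is_ideal (ideal_pow m n).
Proof. by case: n => [|n]; [|exact: smul_submodule]. Qed.

Lemma ideal_powM i j a b : ideal_pow m i a -> ideal_pow m j b ->
  ideal_pow m (i + j) (a * b).
Proof.
elim: i a => [|i IH] a; first by move=> _; apply: (idealM (ideal_pow_ideal j)).
move=> ha hb; move: a ha.
apply: (@smul_min T^o m (ideal_pow m i) [set a : T^o | ideal_pow m (i.+1 + j)
  ((a : T) * b)]).
  have idj := ideal_pow_ideal (i.+1 + j)%N.
  split=> [|x y hx hy|c x hx]; rewrite /mkset ?mul0r ?mulrDl -?mulrA.
  - exact: (ideal0 idj).
  - exact: (idealD idj).
  - exact: (idealM idj).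
move=> x a mx ha /=; rewrite -[_ *: _]/(x * a) -mulrA.
by apply: (@smulP T^o m) => //; apply: IH.
Qed.

Lemma ideal_pow1 a : m a -> ideal_pow m 1 a.
Proof. by move=> ma; rewrite -[a]mulr1; apply: (@smulP T^o m). Qed.

Lemma ideal_pow_exp n a : m a -> ideal_pow m n (a ^+ n).
Proof.
move=> ma; elim: n => [//|n IH]; rewrite exprS -add1n.
by apply: ideal_powM => //; apply: ideal_pow1.
Qed.

Lemma ideal_powW i j : (i <= j)%N -> ideal_pow m j `<=` ideal_pow m i.
Proof.
move=> /subnK <-; move: (j - i)%N => k {j}; elim: k => // k IH a h; apply: IH.
move: a h; rewrite addSn; apply: (@smul_min T^o m (ideal_pow m (k + i)%N)
  (ideal_pow m (k + i)%N)); first exact: ideal_pow_ideal.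
by move=> a x _; apply: (idealM (ideal_pow_ideal _)).
Qed.

Lemma ideal_pow_sub n : ideal_pow m n.+1 `<=` m.
Proof.
by apply: (@smul_min T^o m (ideal_pow m n) m) => // a x ma _;
  apply: (idealMr idm).
Qed.

Lemma adic_submodule V n : is_submodule (@adic T m V n).
Proof. exact: smul_submodule. Qed.

Lemma adicZ V n a (x : V) : ideal_pow m n a -> adic m n (a *: x).
Proof. by move=> ha; apply: smulP. Qed.

Lemma adic_linear V W (f : {linear V -> W}) n x : adic m n x -> adic m n (f x).
Proof.
move: x; apply: (smul_min (S' := f @^-1` adic m n)).
  exact/preimage_submodule/adic_submodule.
by move=> a x ha _ /=; rewrite linearZ; apply: adicZ.
Qed.

Lemma adic_regular n (x : T) : @adic T m T^o n x -> ideal_pow m n x.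
Proof.
move: x; apply: (@smul_min T^o (ideal_pow m n) setT (ideal_pow m n));
  first exact: ideal_pow_ideal.
by move=> a x ha _; apply: (idealMr (ideal_pow_ideal _)).
Qed.

Lemma adic_matrix p q n (A : 'M[T]_(p, q)) :
  (forall i j, ideal_pow m n (A i j)) <-> adic m n A.
Proof.
split=> h; last first.
  move=> i j; apply: adic_regular.
  exact: (adic_linear (mx_entry i j : {linear 'M[T]_(p, q) -> T^o}) h).
rewrite (matrix_sum_delta A); apply: sub_sum => [|i _];
  first exact: adic_submodule.
by apply: sub_sum => [|j _]; [exact: adic_submodule|apply: adicZ].
Qed.
End IdealPow.

(** * Local rings and Nakayama's lemma *)

Section Local.
Variables (T : comUnitRingType) (m : set T).
Hypotheses (T_local : local_ring m) (T_noeth : noetherian T).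

Lemma local_ideal : is_ideal m. Proof. by case: T_local => -[[]]. Qed.
Let idm := local_ideal.

Lemma local_proper : ~ m 1.
Proof.
case: T_local => -[[_ mT] _] _ m1; apply: mT; apply/seteqP; split=> // x _.
by rewrite -[x]mulr1; apply: (idealM idm).
Qed.

Lemma proper_sub_local J : is_ideal J -> ~ J 1 -> J `<=` m.
Proof.
move=> idJ J1.
have [|S|S [idS JS S1] maxS] := @noeth_max T T^o T_noeth
    [set S | [/\ is_ideal S, J `<=` S & ~ S 1]]; [by exists J; split| by case|].
suff <- : S = m by [].
apply: (proj2 T_local); split.
  by split=> // ST; apply: S1; rewrite ST.
move=> S' [idS' S'T] SS'; apply/seteqP; split => //; apply: maxS => //;
  split=> //.
  exact: subset_trans SS'.
move=> S'1; apply: S'T; apply/seteqP; split=> // x _.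
by rewrite -[x]mulr1; apply: (idealM idS').
Qed.

Lemma nonlocal_unit x : ~ m x -> x \is a GRing.unit.
Proof.
move=> mx; apply: contrapT => ux; apply: mx.
have h : is_ideal [set y | exists a, y = a * x].
  split=> [|y z [a ->] [b ->]|c y [a ->]].
  - by exists 0; rewrite mul0r.
  - by exists (a + b); rewrite mulrDl.
  - by exists (c * a); rewrite -mulrA.
apply: (proper_sub_local h) => [[a]|]; last by exists 1; rewrite mul1r.
by move=> ax; apply: ux; apply/unitrPr; exists a; rewrite mulrC.
Qed.

Lemma unit_subm a b : a \is a GRing.unit -> m b -> a - b \is a GRing.unit.
Proof.
move=> ua mb; apply: nonlocal_unit => mab; apply: local_proper.
rewrite -(mulVr ua) -(subrK b a); apply: (idealM idm).
exact: (idealD idm).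
Qed.

(** Otherwise let [C] be maximal among the proper submodules containing [N]. If [a *: z] is outside
    [C] for some [a] in [m], then [C] and [a *: z] span everything, so (1 - t a) z lies in [C] for
    some [t]; as 1 - t a is a unit, so does [z], a contradiction. *)
Lemma nakayama (V : lmodType T) (N : set V) : noeth_mod V -> is_submodule N ->
  (forall x, exists2 y, N y & smul m setT (x - y)) -> N = setT.
Proof.
move=> hV hN h; apply: contrapT => NT.
have [|S|C [hC NC CT] maxC] := @noeth_max T V hV
    [set S | [/\ is_submodule S, N `<=` S & S <> setT]]; [by exists N;
      split|by case|].
apply: CT; apply/seteqP; split=> // x _; have [y Ny mxy] := h x.
rewrite -(subrK y x); apply: subD => //; last exact: NC.
move: mxy; apply: smul_min => // a z ma _.
have [//|Caz] := pselect (C (a *: z)).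
have E : [set w | exists t, C (w - t *: (a *: z))] = setT.
  apply: contrapT => E; apply: Caz;
    apply: (maxC [set w | exists t, C (w - t *: (a *: z))] _ _ (a *: z)).
  - split=> //.
    + split=> [|u v [t ht] [t' ht']|c u [t ht]].
      * by exists 0; rewrite scale0r subr0; apply: sub0.
      * by exists (t + t'); rewrite scalerDl opprD addrACA; apply: subD.
      * by exists (c * t); rewrite -scalerA -scalerBr; apply: subZ.
    + by move=> u Nu; exists 0; rewrite scale0r subr0; apply: NC.
  - by move=> u Cu; exists 0; rewrite scale0r subr0.
  - by exists 1; rewrite scale1r subrr; apply: sub0.
have [t] : [set w | exists t, C (w - t *: (a *: z))] z by rewrite E.
rewrite scalerA -{1}[z]scale1r -scalerBl => Cz; exfalso; apply: Caz.
have u : 1 - t * a \is a GRing.unit by apply: unit_subm;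
  [exact: unitr1|exact: (idealM idm)].
apply: subZ => //; rewrite -[z]scale1r -(mulVr u) -scalerA; exact: subZ.
Qed.
End Local.

(** * A weak form of the Artin-Rees lemma *)

Section ArtinRees.
Variables (T : comNzRingType) (m : set T).
Hypotheses (T_noeth : noetherian T) (idm : is_ideal m).

(** [U] consists of the [b] that some power of [m] multiplies into [J]; since [m] is finitely
    generated, [b] is in [U] once m b is. If [U] is proper, let [b] be outside it with (U : b)
    maximal. For [a] in [m] with [a * b] outside [U], (U : ab) = (U : b), and a power of [a] lying
    in [J] is stripped factor by factor until [b] itself is in [U]. *)
Lemma pow_sub_ideal (J : set T) : is_ideal J ->
  (forall a, m a -> exists k, J (a ^+ k)) -> exists N, ideal_pow m N `<=` J.
Proof.
move=> idJ hJ; pose U := [set b | exists N, forall c, ideal_pow m N c -> J (c * b)].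
suff [N h] : U 1 by exists N => c /h; rewrite mulr1.
have idU : is_ideal U.
  split=> [|x y [N h] [N' h']|a x [N h]].
  - by exists 0%N => c _; rewrite mulr0; apply: ideal0.
  - exists (maxn N N') => c hc; rewrite mulrDr; apply: (idealD idJ).
      by apply: h; apply: ideal_powW hc; rewrite leq_maxl.
    by apply: h'; apply: ideal_powW hc; rewrite leq_maxr.
  - by exists N => c /h hc; rewrite -[_ *: _]/(a * x) mulrCA;
      apply: (idealM idJ).
have JU : J `<=` U by move=> x Jx; exists 0%N => c _; apply: (idealM idJ).
have mU b : (forall a, m a -> U (a * b)) -> U b.
  move=> h; have [s sE] := T_noeth idm.
  have [N hN] : exists N, forall a, a \in s -> forall c, ideal_pow m N c -> J
    (c * (a * b)).
    have : forall a, a \in s -> m a by move=> a sa; rewrite sE; apply: sub_span.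
    elim: s {sE} => [|a s IH] sm; first by exists 0%N.
    have [|N hN] := IH; first by move=> x xs; apply: sm; rewrite inE xs orbT.
    have [|N' hN'] := h a; first by apply: sm; rewrite inE eqxx.
    exists (maxn N N') => x; rewrite inE => /orP[/eqP->|xs] c hc.
      by apply: hN'; apply: ideal_powW hc; rewrite leq_maxr.
    by apply: hN => //; apply: ideal_powW hc; rewrite leq_maxl.
  have hm a c : m a -> ideal_pow m N c -> J (c * (a * b)).
    move=> + hc; rewrite sE; move: a.
    apply: (span_min (S := [set a : T^o | J (c * ((a : T) * b))])).
      split=> [|x y|d x] /=.
      - by rewrite mul0r mulr0; apply: ideal0.
      - by rewrite mulrDl mulrDr; apply: (idealD idJ).
      - by move=> hx; rewrite -[_ *: _]/(d * x) -mulrA mulrCA;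
          apply: (idealM idJ).
    by move=> a sa; apply: hN.
  exists N.+1; apply: (@smul_min T T^o m (ideal_pow m N) [set c : T^o | J ((c :
    T) * b)]).
    split=> [|x y|d x] /=.
    - by rewrite mul0r; apply: ideal0.
    - by rewrite mulrDl; apply: (idealD idJ).
    - by move=> hx; rewrite -[_ *: _]/(d * x) -mulrA; apply: (idealM idJ).
  by move=> a c ma hc /=; rewrite -[_ *: _]/(a * c) mulrAC mulrC mulrA;
    rewrite -mulrA; apply: hm.
apply: contrapT => U1; pose col b := [set c | U (c * b)].
have idcol b : is_ideal (col b).
  split=> [|x y|a x] /=; rewrite /col /= ?mul0r ?mulrDl.
  - exact: ideal0.
  - exact: (idealD idU).
  - by rewrite -[_ *: _]/(a * x) -mulrA; apply: (idealM idU).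
have [||_ [b Ub <-] maxb] := @noeth_max T T^o T_noeth (col @` [set b | ~ U b]).
- by exists (col 1); exists 1.
- by move=> _ [b _ <-]; exact: idcol.
apply: Ub; apply: mU => a ma; apply: contrapT => Uab.
have E : col (a * b) `<=` col b.
  apply: maxb; first by exists (a * b).
  by move=> c; rewrite /col /= mulrCA; apply: (idealM idU).
have [k Jk] := hJ a ma; have : U (a ^+ k * b) by rewrite mulrC;
  apply: (idealM idU); apply: JU.
elim: k {Jk} => [|k IH]; last by move=> h; apply: IH; apply: E;
  rewrite /col /= mulrA -exprSr.
by rewrite expr0 mul1r => Ub; apply: Uab; apply: (idealM idU).
Qed.

(** Let [C] be maximal among the submodules meeting [P] in [L]; by [pow_sub_ideal] it is enough that
    each [a] in [m] has a power carrying [W] into [C]. Once the modules (C : a^k) are stable, C +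
    a^k W still meets [P] in [L], because a^n P lies in [L], and maximality puts a^k W in [C]. *)
Lemma weak_artin_rees (W : lmodType T) (P L : set W) n : noeth_mod W ->
  is_submodule P -> is_submodule L -> L `<=` P ->
  (forall a x, ideal_pow m n a -> P x -> L (a *: x)) ->
  exists N, forall x, adic m N x -> P x -> L x.
Proof.
move=> hW hP hL LP hn.
have [||C [hC CPL] maxC] := @noeth_max T W hW [set C | is_submodule C /\ C `&` P = L].
- by exists L; split=> //; apply/seteqP; split=> x; [case|move=> Lx;
    split => //; apply: LP].
- by move=> S [].
have LC : L `<=` C by rewrite -CPL => x [].
suff hpow a : m a -> exists k, forall x : W, C (a ^+ k *: x).
  have [||N hN] := @pow_sub_ideal [set b | forall x : W, C (b *: x)].
  - split=> [x|b c hb hc x|b c hc x]; first by rewrite scale0r; apply: sub0.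
      by rewrite scalerDl; apply: subD.
    by rewrite -[b *: c]/(b * c) -scalerA; apply: subZ.
  - by move=> a /hpow.
  exists N => x hx Px; rewrite -CPL; split=> //.
  by move: x hx {Px}; apply: smul_min => // a x /hN.
move=> ma; pose col j := [set x : W | C (a ^+ j *: x)].
have hcol j : is_submodule (col j).
  split=> [|x y|c x]; rewrite /col /= ?scaler0 ?scalerDr.
  - exact: sub0.
  - exact: subD.
  - by rewrite scalerA mulrC -scalerA; apply: subZ.
have [||_ [k _ <-] maxk] := @noeth_max T W hW (range col).
- by exists (col 0%N); exists 0%N.
- by move=> _ [j _ <-]; exact: hcol.
have stab x : C (a ^+ (n + k) *: x) -> C (a ^+ k *: x).
  apply: (maxk (col (n + k)%N)); first by exists (n + k)%N.
  by move=> y; rewrite /col /= exprD -scalerA; apply: subZ.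
exists k => x.
pose D := [set w | exists y, C (w - a ^+ k *: y)].
have hD : is_submodule D.
  split=> [|u v [y hy] [z hz]|c u [y hy]].
  - by exists 0; rewrite scaler0 subr0; apply: sub0.
  - by exists (y + z); rewrite scalerDr opprD addrACA; apply: subD.
  - by exists (c *: y); rewrite scalerA mulrC -scalerA -scalerBr; apply: subZ.
have CD : C `<=` D by move=> w Cw; exists 0; rewrite scaler0 subr0.
apply: (maxC D) => //; last by exists x; rewrite subrr; apply: sub0.
split=> //; apply/seteqP; split=> w; last by move=> Lw; split;
  [apply/CD/LC|apply: LP].
case=> -[y hy] Pw.
have Cy : C (a ^+ k *: y).
  apply: stab; rewrite exprD -scalerA.
  have -> : a ^+ n *: (a ^+ k *: y) = a ^+ n *: w - a ^+ n *: (w - a ^+ k *: y).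
    by rewrite -scalerBr; congr (_ *: _); rewrite opprB addrC subrK.
  apply: subB => //; last exact: subZ.
  by apply: LC; apply: hn => //; apply: ideal_pow_exp.
by rewrite -CPL; split=> //; rewrite -(subrK (a ^+ k *: y) w); apply: subD.
Qed.
End ArtinRees.

(** * Field factors *)

Section Corner.
Variables (K : comNzRingType) (e : K).

Definition corner_pred : pred K := fun x => e * x == x.
(** The ring eK with unit [e]; it may be the zero ring, as happens to the complement (1 - e)K when
    [e] is 1. *)
Definition corner (ee : e * e = e) := {x : K | corner_pred x}.

Fact corner_zmod_closed : zmod_closed corner_pred.
Proof.
have E x : (x \in corner_pred) = (e * x == x) by [].
split=> [|x y]; rewrite !E ?mulr0 // => /eqP ex /eqP ey.
by rewrite mulrBr ex ey.
Qed.
HB.instance Definition _ := GRing.isZmodClosed.Build K corner_pred corner_zmod_closed.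

Variable ee : e * e = e.
Local Notation C := (corner ee).
HB.instance Definition _ := SubType.on C.
HB.instance Definition _ := [Choice of C by <:].
HB.instance Definition _ := [SubChoice_isSubZmodule of C by <:].

Definition cval (x : C) : K := \val x.
Lemma cval_inj : injective cval. Proof. exact: val_inj. Qed.
Lemma cvalD : {morph cval : x y / x + y}. Proof. exact: raddfD. Qed.
Lemma cvalB : {morph cval : x y / x - y}. Proof. exact: raddfB. Qed.
Lemma cval0 : cval 0 = 0. Proof. exact: raddf0. Qed.

Fact corner_projP (x : K) : corner_pred (e * x).
Proof. by rewrite /corner_pred mulrA ee. Qed.
Definition corner_proj (x : K) : C := Sub (e * x) (corner_projP x).
Lemma val_corner_proj x : cval (corner_proj x) = e * x. Proof. exact: SubK. Qed.
Lemma corner_valE (x : C) : e * cval x = cval x.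
Proof. by apply/eqP; exact: (valP x). Qed.

Definition corner_mul (x y : C) : C := corner_proj (cval x * cval y).
Lemma val_corner_mul x y : cval (corner_mul x y) = cval x * cval y.
Proof. by rewrite val_corner_proj mulrA corner_valE. Qed.
Definition corner_one : C := corner_proj 1.
Lemma val_corner_one : cval corner_one = e.
Proof. by rewrite val_corner_proj mulr1. Qed.

Fact corner_mulA : associative corner_mul.
Proof. by move=> x y z; apply: cval_inj; rewrite !val_corner_mul mulrA. Qed.
Fact corner_mulC : commutative corner_mul.
Proof. by move=> x y; apply: cval_inj; rewrite !val_corner_mul mulrC. Qed.
Fact corner_mul1 : left_id corner_one corner_mul.
Proof.
by move=> x; apply: cval_inj; rewrite val_corner_mul val_corner_one corner_valE.
Qed.
Fact corner_mulDl : left_distributive corner_mul +%R.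
Proof.
move=> x y z; apply: cval_inj.
by rewrite cvalD !val_corner_mul cvalD mulrDl.
Qed.
HB.instance Definition _ := GRing.Zmodule_isComPzRing.Build C
  corner_mulA corner_mulC corner_mul1 corner_mulDl.

Fact corner_proj_additive : zmod_morphism corner_proj.
Proof.
by move=> x y; apply: cval_inj; rewrite cvalB !val_corner_proj mulrBr.
Qed.
Fact corner_proj_multiplicative : monoid_morphism corner_proj.
Proof.
split=> // x y; apply: cval_inj.
by rewrite val_corner_mul !val_corner_proj mulrACA ee.
Qed.
HB.instance Definition _ := GRing.isZmodMorphism.Build K C corner_proj
  corner_proj_additive.
HB.instance Definition _ := GRing.isMonoidMorphism.Build K C corner_proj
  corner_proj_multiplicative.
End Corner.

Section CornerFactor.
Variables (K : comUnitRingType) (e : K).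
Hypothesis (ee : e * e = e) (e0 : e != 0).
Hypothesis inv_e : forall x, e * x != 0 -> exists y, e * x * y = e.

Let C := corner ee.

Let cv : C -> K := @cval K e ee.

Lemma corner_inv_ex (x : C) : exists y : C, (x != 0 -> y * x = 1) /\ (x = 0 -> y = 0).
Proof.
have [->|x0] := eqVneq x 0; first by exists 0; split=> //; rewrite eqxx.
have xne : e * cv x != 0.
  rewrite corner_valE; apply: contra x0 => /eqP vx.
  by apply/eqP; apply: cval_inj; rewrite vx cval0.
have [y xy] := inv_e xne.
exists (corner_proj ee y); split=> [_|x0']; last by rewrite x0' eqxx in x0.
apply: cval_inj; rewrite [LHS]val_corner_mul [RHS]val_corner_one val_corner_proj.
by rewrite -[RHS]xy mulrAC.
Qed.

Lemma field_factor_corner : exists (k : fieldType) (pi : {rmorphism K -> k}),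
  field_factor pi /\ forall x, e * x != 0 -> pi x != 0.
Proof.
have one_neq0 : 1 != 0 :> C.
  by apply: contra e0 => /eqP /(congr1 (@cval _ _ _)) /=;
    rewrite [LHS]val_corner_one cval0 => ->.
pose inv (x : C) := projT1 (cid (corner_inv_ex x)).
pose Cnz : comNzRingType := HB.pack (corner ee)
  (GRing.PzSemiRing_isNonZero.Build (corner ee) one_neq0).
have mulVf (x : Cnz) : x != 0 -> inv x * x = 1.
  by rewrite /inv; case: cid => y [].
have inv0 : inv (0 : Cnz) = 0 by exact: (proj2 (projT2 (cid (corner_inv_ex 0)))
  erefl).
pose k : fieldType := HB.pack Cnz (GRing.ComNzRing_isField.Build Cnz mulVf inv0).
have ff : (1 - e) * (1 - e) = 1 - e.
  by rewrite mulrBr mulr1 mulrBl mul1r ee subrr subr0.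
exists k, (corner_proj ee : {rmorphism K -> k}); split.
  exists (corner ff), (corner_proj ff : {rmorphism K -> corner ff}).
  exists (fun xy => cv xy.1 + @cval _ _ ff xy.2) => [x|[x y]] /=.
    by rewrite !val_corner_proj -mulrDl addrC subrK mul1r.
  have eE : e * (cv x + @cval _ _ ff y) = cv x.
    rewrite mulrDr corner_valE -(corner_valE (ee := ff) y) mulrA.
    by rewrite mulrBr mulr1 ee subrr mul0r addr0.
  congr (_, _); apply: cval_inj; rewrite val_corner_proj //.
  by rewrite mulrBl mul1r eE addrC addKr.
move=> x; apply: contra => /eqP px0; apply/eqP.
rewrite -(val_corner_proj ee x).
have -> : corner_proj ee x = 0 by exact: px0.
exact: cval0.
Qed.
End CornerFactor.

Section FieldFactors.
Variables (T : comUnitRingType) (K : comUnitRingType) (iota : {rmorphism T -> K}).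
Hypotheses (T_noeth : noetherian T) (T_red : reduced T).
Hypothesis K_frac : total_ring_of_fractions iota.

Definition ann (y : T) : set T := [set c | c * y = 0].
Lemma ann_ideal y : is_ideal (ann y).
Proof.
split=> [|a b|a b]; rewrite /ann /= ?mul0r // ?mulrDl.
  by move=> -> ->; rewrite addr0.
by move=> h; rewrite -[a *: b]/(a * b) -mulrA h mulr0.
Qed.

Lemma reduced_sqr (x : T) : x * x = 0 -> x = 0.
Proof. by move=> h; apply: (T_red (n := 2)); rewrite expr2. Qed.

(** Let [a] be a numerator of [x], and [y] a nonzero multiple of [a] whose annihilator [p] is
    maximal, hence prime. Some [z] in [p] has an annihilator that meets [p] in 0 only; then y + z is
    regular, e = y / (y + z) is idempotent, eK is a field and e x is nonzero. *)
Theorem exists_field_factor (x : K) : x != 0 ->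
  exists (k : fieldType) (pi : {rmorphism K -> k}), field_factor pi /\ pi x != 0.
Proof.
case: K_frac => inj reg frac x0.
have [a [s [sreg xE]]] := frac x.
have a0 : a <> 0 by move=> a0; rewrite xE a0 rmorph0 mul0r eqxx in x0.
have [||_ [y [[b yE] y0] <-] maxy] := @noeth_max T T^o T_noeth
   (ann @` [set y | (exists b, y = b * a) /\ y <> 0]).
- by exists (ann a), a => //; split=> //; exists 1; rewrite mul1r.
- by move=> _ [y _ <-]; exact: ann_ideal.
have prime u v : ann y (u * v) -> ~ ann y v -> ann y u.
  rewrite /ann /= => uv v0.
  apply: (maxy (ann (v * y))).
  - by exists (v * y) => //; split=> //; exists (v * b); rewrite yE mulrA.
  - by move=> c; rewrite /ann /= mulrCA => ->; rewrite mulr0.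
  - by rewrite /ann /= mulrA.
(* [A z] annihilates the part of [p] that [z] kills. For [w] in that part, [A (z + w)] contains
   [A z] and [w]; maximality then gives [w * w = 0], so [w = 0] as [T] is reduced. *)
pose p := ann y; pose A z := [set c | forall w, ann z w -> p w -> c * w = 0].
have [||_ [z pz <-] maxz] := @noeth_max T T^o T_noeth (A @` p).
- by exists (A 0), 0 => //; rewrite /p /ann /= mul0r.
- move=> _ [z _ <-]; split=> [w|c d hc hd w|c d hd w] zw pw.
  + by rewrite mul0r.
  + by rewrite mulrDl hc // hd // addr0.
  + by rewrite -[c *: d]/(c * d) -mulrA hd // mulr0.
have annz w : ann z w -> p w -> w = 0.
  move=> zw pw; apply: contrapT => w0.
  have annzw c : c * (z + w) = 0 -> c * z = 0 /\ c * w = 0.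
    move=> h; have cz : c * z = 0.
      apply: reduced_sqr; have -> : c * z * (c * z) = c * z * (c * (z + w)) - c
        * c * (w * z) by ring.
      by rewrite h zw !mulr0 subrr.
    by split=> //; move: h; rewrite mulrDr cz add0r.
  have : A z w.
    apply: (maxz (A (z + w))).
    - exists (z + w) => //; rewrite /p; exact: (idealD (ann_ideal y)).
    - by move=> c hc d /annzw [zd _] pd; apply: hc.
    - by move=> d /annzw [_ dw] _; rewrite mulrC.
  by move=> /(_ w zw pw) /reduced_sqr.
have yz : y * z = 0 by rewrite mulrC.
have lreg_of (u : T) : (forall c, c * u = 0 -> c = 0) -> GRing.lreg u.
  by move=> h; apply: mulrI0_lreg => c; rewrite mulrC; apply: h.
have reg_bz c : ~ p c -> iota (c * y + z) \is a GRing.unit.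
  move=> pc; apply: reg; apply: lreg_of => d hd.
  have dy : p d.
    apply: (prime d c) => //; rewrite /ann /=.
    apply: reduced_sqr.
    have -> : d * c * y * (d * c * y) = d * c * y * (d * (c * y + z)) - d * d *
      c * (y * z) by ring.
    by rewrite hd yz !mulr0 subrr.
  apply: annz => //; rewrite /ann /=.
  have -> : d * z = d * (c * y + z) - c * (d * y) by ring.
  by rewrite hd dy mulr0 subrr.
have p1 : ~ p 1 by rewrite /p /ann /= mul1r.
have := reg_bz 1 p1; rewrite mul1r => u_unit.
pose u := iota (y + z); pose e := iota y / u.
have eu : e * u = iota y by rewrite divrK.
have yy : iota y * iota y = iota y * u.
  by rewrite /u -!rmorphM mulrDr yz addr0.
have ee : e * e = e.
  by rewrite /e mulrACA yy -mulrA [u * _]mulrA divrr // mul1r.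
have ey : e * iota y = iota y.
  by rewrite -eu mulrA ee.
have e0 : e != 0.
  apply/eqP => e0; apply: y0; apply: inj; rewrite -eu e0 mul0r rmorph0; by [].
have ex0 : e * x != 0.
  apply/eqP => ex; apply: y0; apply: reduced_sqr.
  apply: inj; rewrite rmorphM rmorph0 {1}yE -ey rmorphM.
  have -> : iota a = x * iota s by rewrite xE divrK //; apply: reg.
  have -> : iota b * (x * iota s) * (e * iota y) = (e * x) * (iota b * iota s *
    iota y) by ring.
  by rewrite ex mul0r.
have [|k [pi [ff hpi]]] := field_factor_corner ee e0; last first.
  by exists k, pi; split=> //; apply: hpi.
move=> w ew; have [c [t [treg wE]]] := frac w.
have pc : ~ p c.
  move=> pc; move/eqP: ew; apply.
  have -> : e * w = iota (c * y) / u / iota t by rewrite wE /e rmorphM; ring.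
  by rewrite pc rmorph0 !mul0r.
have v_unit := reg_bz c pc.
set v := iota (c * y + z) in v_unit.
have ev : e * v = e * iota c * iota y.
  rewrite /v rmorphD rmorphM mulrDr.
  have -> : e * iota z = 0.
    by rewrite /e mulrAC -rmorphM yz rmorph0 mul0r.
  by rewrite addr0 mulrA.
(* For w = c / t the inverse of e w in eK is t y / (c y + z), because [e] kills [z]. *)
exists (iota t * iota y / v).
have -> : e * w * (iota t * iota y / v) = (e * iota c * iota y) / v * (iota t /
  iota t).
  by rewrite wE; ring.
by rewrite divrr ?mulr1 -?ev ?mulrK //; apply: reg.
Qed.
End FieldFactors.

(** * Roots of quadratic polynomials in a complete local ring *)

Section Hensel.
Variables (T : comUnitRingType) (m I : set T).
Hypotheses (T_local : local_ring m) (T_noeth : noetherian T).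
Hypothesis T_complete : adically_complete m.
Hypotheses (idI : is_ideal I) (Im : I `<=` m).

(* The iteration x |-> (d + x^2) / t is a contraction on I. *)
Lemma quadratic_root (t d : T) : t \is a GRing.unit -> I d ->
  exists2 x, I x & x ^+ 2 - t * x + d = 0.
Proof.
move=> ut Id; have idm := local_ideal T_local.
pose step x := (d + x ^+ 2) / t; pose u n := iter n step 0.
have Iu n : I (u n).
  elim: n => [|n IH]; first exact: ideal0.
  rewrite /u iterS -/(u n) /step; apply: (idealMr idI);
    apply: (idealD idI) => //.
  by rewrite expr2; apply: (idealM idI).
have stepB x y : step x - step y = (x - y) * (x + y) / t.
  by rewrite /step -mulrBl; congr (_ / t); ring.
have du n : ideal_pow m n.+1 (u n.+1 - u n).
  elim: n => [|n IH].
    by apply: ideal_pow1 => //; apply: Im; apply: (idealB idI).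
  have h1 : ideal_pow m 1 ((u n.+1 + u n) / t).
    by apply: ideal_pow1 => //; apply: Im; apply: (idealMr idI);
      apply: (idealD idI).
  by have := ideal_powM IH h1; rewrite addn1 mulrA -stepB.
have cu n k : ideal_pow m n.+1 (u (n + k)%N - u n).
  elim: k => [|k IH]; first by rewrite addn0 subrr;
    apply: (ideal0 (ideal_pow_ideal m n.+1)).
  have -> : u (n + k.+1)%N - u n = (u (n + k).+1 - u (n + k)%N) + (u (n + k)%N - u n).
    by rewrite addnS; ring.
  apply: (idealD (ideal_pow_ideal m n.+1)) => //.
  by apply: (ideal_powW (j := (n + k).+1)) => //; rewrite ltnS leq_addr.
have [sep compl] := T_complete.
have [n|x ux] := compl u.
  exists n => i j ni nj; have idn := ideal_pow_ideal m n.
  have -> : u i - u j = (u i - u n) - (u j - u n) by ring.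
  rewrite -(subnKC ni) -(subnKC nj).
  by apply: (idealB idn); apply: (ideal_powW (leqnSn n)).
have lim n : exists2 k, (n <= k)%N & ideal_pow m n (u k - x).
  have : filtration_nbhs (ideal_pow m) x [set y | ideal_pow m n (y - x)] by exists n.
  move=> /ux [N _ hN]; exists (maxn n N); first exact: leq_maxl.
  by apply: hN; rewrite /= leq_maxr.
have mx : m x.
  have [k _ hk] := lim 1%N; have -> : x = u k - (u k - x) by ring.
  by apply: (idealB idm); [apply: Im|apply: ideal_pow_sub hk].
have root0 : x ^+ 2 - t * x + d = 0.
  apply: sep => n; have [k nk hk] := lim n; have idn := ideal_pow_ideal m n.
  have -> : x ^+ 2 - t * x + d =
     t * (u k.+1 - u k) + (t - x - u k) * (u k - x).
    have : t * u k.+1 = d + u k ^+ 2 by rewrite /u iterS -/(u k) /step mulrC divrK.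
    by rewrite mulrBr => ->; ring.
  apply: (idealD idn); last exact: (idealM idn).
  by apply: (idealM idn); apply: (ideal_powW (j := k.+1)) => //; apply: leqW.
(* The limit has only been placed in [m]; the equation x (t - x) = d, with t - x a unit, puts it in
   [I]. *)
exists x => //.
have ux' : t - x \is a GRing.unit by apply: (unit_subm T_local T_noeth).
have -> : x = (t - x)^-1 * d.
  by apply: (mulrI ux'); rewrite mulVKr //; apply/eqP;
    rewrite -subr_eq0 -oppr_eq0 -root0; apply/eqP; ring.
exact: (idealM idI).
Qed.
End Hensel.

(** * Singular matrices and irreducibility *)

Section Sandwich.
Variable K : comNzRingType.
Variable q : 'M[K]_2.
Hypothesis q0 : \det q = 0.

Definition sandwich (x : 'M[K]_2) := q *m x *m conj2 q.

Lemma sandwich_linear : linear sandwich.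
Proof.
by move=> c x y; rewrite /sandwich mulmxDr mulmxDl -scalemxAr -scalemxAl.
Qed.
HB.instance Definition _ := GRing.isLinear.Build K 'M[K]_2 'M[K]_2 _ sandwich
  sandwich_linear.

(** By Cayley-Hamilton tr(q) q = q^2, as [q] is singular. Polarity then turns q a^* into a scalar
    minus a q^*, and q^* b q^* is tr(q^* b) times q^*. *)
Lemma sandwich_conj2 a b :
  \tr q *: sandwich (conj2 a *m b) =
  \tr (conj2 q *m a) *: sandwich b - \tr (conj2 q *m b) *: sandwich a.
Proof.
have qq : q *m conj2 q = 0 by rewrite mul_conj2 q0 raddf0.
have q2 : \tr q *: q = q *m q.
  by rewrite -mul_mx_scalar -[_%:M](subrK q) -conj2E mulmxDr qq add0r.
have qa : q *m conj2 a = (\tr (conj2 q *m a))%:M - a *m conj2 q.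
  by rewrite -mul_conj2_polar addrK.
set c := \tr (conj2 q *m b).
have qb : conj2 q *m b *m conj2 q = c *: conj2 q.
  have -> : conj2 q *m b = c%:M - conj2 b *m q by rewrite /c -conj2_mul_polar addrK.
  by rewrite mulmxBl mul_scalar_mx -mulmxA qq mulmx0 subr0.
rewrite /sandwich [LHS]scalemxAl [X in X *m _ = _]scalemxAl q2 -[q *m q *m
  _]mulmxA [q *m (conj2 a *m b)]mulmxA qa.
rewrite mulmxBl mul_scalar_mx mulmxBr mulmxBl -scalemxAr -scalemxAl;
  congr (_ - _).
by rewrite -!mulmxA [conj2 q *m (b *m _)]mulmxA qb -!scalemxAr.
Qed.

Lemma sandwich_shift l : sandwich (q + l%:M) = 0.
Proof.
have qq : q *m conj2 q = 0 by rewrite mul_conj2 q0 raddf0.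
by rewrite /sandwich mulmxDr mulmxDl -mulmxA qq mulmx0 mul_mx_scalar -scalemxAl
  qq scaler0 addr0.
Qed.
End Sandwich.

Section Irreducible.
Variables (k : fieldType) (G : groupType) (rho : G -> 'M[k]_2).
Hypothesis irr : irreducible_rep rho.

Lemma irreducible_no_eigenvector (w : 'cV[k]_2) :
  (forall g, exists a, rho g *m w = a *: w) -> w = 0.
Proof.
move=> h; have [_ /(_ <[w]>%VS)] := irr; case.
- move=> g _ /vlineP[a ->]; have [b hb] := h g.
  by apply/vlineP; exists (a * b); rewrite -scalemxAr hb scalerA.
- by move/eqP; rewrite -subv0 -memvE memv0 => /eqP.
move=> wf; have := dim_vline w; rewrite wf dimvf /= /dim /=.
by case: eqP.
Qed.

Lemma irreducible_nonscalar :
  ~ (forall g, exists a, rho g = a%:M).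
Proof.
move=> h; have : delta_mx 0 0 = 0 :> 'cV[k]_2.
  apply: irreducible_no_eigenvector => g.
  by have [a ->] := h g; exists a; rewrite mul_scalar_mx.
by move=> /matrixP/(_ 0 0); rewrite !mxE /= => /eqP; rewrite oner_eq0.
Qed.

(** A nonzero row (a, b) of [q] annihilates only the multiples of (-b, a), which up to sign is a
    column of [conj2 q]. Hence every rho(g) carries each column of [conj2 q] to a multiple of
    itself, and irreducibility makes it zero. *)
Lemma irreducible_sandwich (q : 'M[k]_2) : \det q = 0 ->
  (forall g, sandwich q (rho g) = 0) -> q = 0.
Proof.
move=> dq hq; have {}hq g : q *m (rho g) *m conj2 q = 0 := hq g.
have key (a b y z : k) : a * y + b * z = 0 -> (a = 0 -> b = 0 -> y = 0 /\ z = 0) ->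
    exists c, y = - (c * b) /\ z = c * a.
  move=> e h; have [a0|a0] := eqVneq a 0; last first.
    exists (z / a); rewrite divfK //; split=> //; apply: (mulfI a0).
    rewrite mulrN mulrA mulrCA divff // mulr1; apply/eqP; rewrite -addr_eq0;
      apply/eqP.
    by rewrite [z * b]mulrC.
  have [b0|b0] := eqVneq b 0; first by exists 0; rewrite !mul0r oppr0; apply: h.
  exists (- (y / b)); rewrite mulNr divfK // opprK a0 mulr0; split=> //.
  by move/eqP: e; rewrite a0 mul0r add0r mulf_eq0 (negPf b0) => /eqP.
have cE : [/\ conj2 q 0 0 = q 1 1, conj2 q 1 0 = - q 1 0, conj2 q 0 1 = - q 0 1 &
    conj2 q 1 1 = q 0 0].
  by rewrite conj2E !mxE tr2E /= !(mulr1n, mulr0n); split; ring.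
case: cE => c00 c10 c01 c11.
have hg g i j : q i 0 * (rho g *m conj2 q) 0 j + q i 1 * (rho g *m conj2 q) 1 j = 0.
  by rewrite -mul2E mulmxA hq mxE.
have w1 : col 1 (conj2 q) = 0.
  apply: irreducible_no_eigenvector => g; rewrite !colE mulmxA -!colE.
  have [|c [y z]] := key _ _ _ _ (hg g 0 1).
    by move=> a0 b0; rewrite !mul2E c01 c11 a0 b0 oppr0 !mulr0 addr0.
  exists c; apply/colP => i; rewrite [LHS]mxE [RHS]mxE [col _ _ _ _]mxE.
  by case: (ord2P i) => ->; rewrite ?y ?z ?c01 ?c11 ?mulrN.
have w0 : col 0 (conj2 q) = 0.
  apply: irreducible_no_eigenvector => g; rewrite !colE mulmxA -!colE.
  have [|c [y z]] := key _ _ _ _ (hg g 1 0).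
    by move=> a0 b0; rewrite !mul2E c00 c10 a0 b0 oppr0 !mulr0 addr0.
  exists (- c); apply/colP => i; rewrite [LHS]mxE [RHS]mxE [col _ _ _ _]mxE.
  by case: (ord2P i) => ->; rewrite ?y ?z ?c00 ?c10 ?mulrNN ?mulNr.
move/colP: w1 => w1; move/colP: w0 => w0.
have := w1 0; have := w1 1; have := w0 0; have := w0 1;
  rewrite !mxE c00 c01 c10 c11.
move=> /eqP; rewrite oppr_eq0 => /eqP h1 h2 h3 /eqP;
  rewrite oppr_eq0 => /eqP h4.
by apply: mx2P; rewrite mxE.
Qed.
End Irreducible.

(** * Determinants modulo an ideal, and Fitting ideals *)

Section DetCongr.
Variables (T : comNzRingType) (I : set T).
Hypothesis idI : is_ideal I.

Lemma det_congr n (A B : 'M[T]_n) : (forall i j, I (A i j - B i j)) ->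
  I (\det A - \det B).
Proof.
move=> h; rewrite /determinant -sumrB; apply: (ideal_sum idI) => s _.
rewrite -mulrBr; apply: (idealM idI).
elim/big_rec2: _ => [|i x y _ IH]; first by rewrite subrr; apply: ideal0.
set a := A i _; set b := B i _; have Iab : I (a - b) by apply: h.
have -> : a * y - b * x = (a - b) * y + b * (y - x) by ring.
by apply: (idealD idI); [apply: (idealMr idI)|apply: (idealM idI)].
Qed.
End DetCongr.

Section FittQuotient.
Variables (T : comNzRingType) (I : set T).
Hypotheses (T_noeth : noetherian T) (idI : is_ideal I).

(** Generators of [N] form the rows of a presentation matrix, and each maximal minor is the
    determinant of [n] vectors of [N]. *)
Lemma Fitt_sub n (N : set 'rV[T]_n) (M : lmodType T) (p : {linear 'rV[T]_n -> M}) :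
  (forall y, exists x, p x = y) -> (forall x, p x = 0 <-> N x) -> is_submodule N ->
  (forall B : 'M[T]_n, (forall i, N (row i B)) -> I (\det B)) ->
  Fitt M `<=` I.
Proof.
move=> ps pN hN hB x xF.
have [s sE] := noeth_matrix T_noeth hN.
pose A : 'M[T]_(size s, n) := \matrix_i s`_i.
have NA i : N (row i A).
  by rewrite rowK sE; apply: sub_span; rewrite /= mem_nth.
have AP : is_presentation A p.
  split=> // v; rewrite pN sE span_seqP; split=> [[c ->]|[u ->]].
    exists (\row_i c i); rewrite mulmx_sum_row; apply: eq_bigr => i _.
    by rewrite mxE rowK.
  (* [span_seqP] takes coefficients indexed by all natural numbers, so [u] is extended by 0. *)
  exists (fun i => oapp (u 0) 0 (insub i)).
  by rewrite mulmx_sum_row; apply: eq_bigr => i _;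
    rewrite rowK insubT //= => ?; congr (u _ _ *: _); apply: val_inj.
have := xF _ _ A p AP; apply: (span_min (V := T^o)) => //.
move=> _ [f _ ->]; apply: hB => i.
by have -> : row i (rowsub f A) = row (f i) A by apply/rowP => j; rewrite !mxE.
Qed.
End FittQuotient.

(** * Restriction of scalars and finite generation *)

Section Restriction.
Variables (T K : comNzRingType) (iota : {rmorphism T -> K}) (V : lmodType K).

(** The morphism is recorded in the type so that the scalar action of [T] can be inferred from
    it. *)
Definition restr of {rmorphism T -> K} : Type := V.
Local Notation R := (restr iota).
HB.instance Definition _ := GRing.Zmodule.on R.

Definition restr_scale (a : T) (x : R) : R := iota a *: (x : V).
Fact restr_scaleA a b x : restr_scale a (restr_scale b x) = restr_scale (a * b) x.
Proof. by rewrite /restr_scale scalerA rmorphM. Qed.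
Fact restr_scale1 : left_id 1 restr_scale.
Proof. by move=> x; rewrite /restr_scale rmorph1 scale1r. Qed.
Fact restr_scaleDr : right_distributive restr_scale +%R.
Proof. by move=> a x y; apply: scalerDr. Qed.
Fact restr_scaleDl x : {morph restr_scale^~ x : a b / a + b}.
Proof. by move=> a b; rewrite /restr_scale rmorphD; apply: scalerDl. Qed.
HB.instance Definition _ := GRing.Zmodule_isLmodule.Build T R
  restr_scaleA restr_scale1 restr_scaleDr restr_scaleDl.

Lemma restrZ a (x : R) : a *: x = iota a *: (x : V) :> V. Proof. by []. Qed.
End Restriction.

Section RestrictedMap.
Variables (T K : comNzRingType) (iota : {rmorphism T -> K}) (V W : lmodType K).
Variable f : {linear V -> W}.

Definition restr_map (x : restr V iota) : restr W iota := f x.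
Lemma restr_map_linear : linear restr_map.
Proof. by move=> a x y; rewrite /restr_map; apply: (linearP f (iota a)). Qed.
HB.instance Definition _ := GRing.isLinear.Build T (restr V iota) (restr W iota) _
  restr_map restr_map_linear.
End RestrictedMap.

Section FiniteGeneration.
Variable T : comNzRingType.
Implicit Types V W : lmodType T.

Lemma noeth_range V W (f : {linear V -> W}) (S : set W) : noeth_mod V ->
  is_submodule S -> S `<=` range f -> finitely_generated S.
Proof.
move=> hV hS Sf; have [s sE] := hV _ (preimage_submodule f hS).
exists (map f s).
have -> : [set` map f s] = f @` [set` s].
  by apply/seteqP; split=> y /=; [move/mapP => [z zs ->];
    exists z|move=> [z zs <-]; apply: map_f].
rewrite -image_span -sE; apply/seteqP; split=> [y Sy|_ [x hx <-]] //.
by have [x _ fx] := Sf y Sy; exists x => //=; rewrite fx.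
Qed.

Definition pair_inr V W (y : W) : V * W := (0, y).
Lemma pair_inr_linear V W : linear (@pair_inr V W).
Proof. by move=> a x y; congr (_, _); rewrite /= scaler0 addr0. Qed.
HB.instance Definition _ V W := GRing.isLinear.Build T W (V * W)%type _
  (@pair_inr V W) (@pair_inr_linear V W).

Lemma noeth_prod V W : noeth_mod V -> noeth_mod W -> noeth_mod (V * W)%type.
Proof.
move=> hV hW S hS; pose f : {linear (V * W)%type -> V} := @fst V W.
apply: (fg_extension (f := f)) => //; first exact/hV/image_submodule.
apply: (noeth_range (f := @pair_inr V W : {linear _ -> _}) hW).
  apply: is_submoduleI => //; split=> [|x y|a x];
    rewrite /mkset ?linear0 // ?linearD ?linearZ /=.
    by move=> -> ->; rewrite addr0.
  by move=> ->; rewrite scaler0.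
by move=> [x y] [_ /= ->]; exists y.
Qed.

Lemma span_finite V (X : set V) x : submodule_span X x ->
  exists2 s : seq V, [set` s] `<=` X & submodule_span [set` s] x.
Proof.
move: x; apply: (span_min (S := [set x | exists2 s : seq V, [set` s] `<=` X &
  submodule_span [set` s] x])).
  split=> [|x y [s sX hx] [t tX hy]|a x [s sX hx]].
  - by exists [::] => //; apply: sub0; exact: span_submodule.
  - exists (s ++ t); first by move=> z /=; rewrite mem_cat => /orP[/sX|/tX].
    apply: (subD (span_submodule _)).
      by apply: (span_mono _ hx) => z /= zs; rewrite mem_cat zs.
    by apply: (span_mono _ hy) => z /= zs; rewrite mem_cat zs orbT.
  - by exists s => //; apply: (subZ _ (span_submodule _)).
move=> x Xx; exists [:: x]; first by move=> y; rewrite /= inE => /eqP->.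
by apply: sub_span; rewrite /= inE.
Qed.

(** Each of finitely many generators involves finitely many elements of [X]. This allows generators
    of the span of the r_g to be chosen among the r_g. *)
Lemma fg_span_sub V (X : set V) : finitely_generated (submodule_span X) ->
  exists2 s : seq V, [set` s] `<=` X & submodule_span [set` s] = submodule_span X.
Proof.
move=> [t tE]; suff [s sX hs] : exists2 s : seq V, [set` s] `<=` X & [set` t]
  `<=` submodule_span [set` s].
  exists s => //; apply/seteqP; split; first exact: span_mono.
  by rewrite tE; apply: span_min hs; exact: span_submodule.
have : [set` t] `<=` submodule_span X by rewrite tE; apply: sub_span.
elim: t {tE} => [|x t IH] ht; first by exists [::].
have [y yt|s sX hs] := IH; first by apply: ht; rewrite /= inE yt orbT.
have [|s' s'X hs'] := @span_finite _ X x; first by apply: ht;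
  rewrite /= inE eqxx.
exists (s' ++ s); first by move=> z /=; rewrite mem_cat => /orP[/s'X|/sX].
move=> y /=; rewrite inE => /orP[/eqP->|/hs hy].
  by apply: (span_mono _ hs') => z /= zs; rewrite mem_cat zs.
by apply: (span_mono _ hy) => z /= zs; rewrite mem_cat zs orbT.
Qed.
End FiniteGeneration.

Section Lincomb.
Variables (T : comNzRingType) (V : lmodType T) (n : nat) (r : 'I_n -> V).
Definition lincomb (v : 'rV[T]_n) : V := \sum_k v 0 k *: r k.
Lemma lincomb_linear : linear lincomb.
Proof.
move=> a u v; rewrite /lincomb scaler_sumr -big_split; apply: eq_bigr => k _.
by rewrite !mxE scalerDl scalerA.
Qed.
HB.instance Definition _ := GRing.isLinear.Build T 'rV[T]_n V _ lincomb
  lincomb_linear.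

Lemma lincomb_delta k : lincomb (delta_mx 0 k) = r k.
Proof.
rewrite /lincomb (bigD1 k) //= big1 ?addr0 => [|l lk]; rewrite mxE eqxx ?eqxx.
  by rewrite scale1r.
by rewrite (negPf lk) scale0r.
Qed.
End Lincomb.

Lemma char_congr_coef (T : comNzRingType) (K : comUnitRingType)
    (iota : {rmorphism T -> K}) (I : set T) (A : 'M[K]_2) a b :
  poly_congr iota I (char_poly A) (('X - a%:P) * ('X - b%:P)) -> is_ideal I ->
  exists td : T * T, [/\ \tr A = iota td.1, \det A = iota td.2,
    I (td.1 - (a + b)) & I (td.2 - a * b)].
Proof.
move=> h idI; have [t tE It] := h 1%N; have [d dE Id] := h 0%N.
exists (- t, d); split=> /=.
- by rewrite rmorphN -tE (char_poly_trace A) ?opprK.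
- by rewrite -dE char_poly_det sqrrN expr1n mul1r.
- have -> : - t - (a + b) = - (t - (('X - a%:P) * ('X - b%:P))`_1).
    by rewrite mulrBl coefB coefXM coefCM !coefB !coefX !coefC /=; ring.
  exact: idealN.
- have <- : d - (('X - a%:P) * ('X - b%:P))`_0 = d - a * b.
    by rewrite mulrBl coefB coefXM coefCM !coefB !coefX !coefC /=; ring.
  exact: Id.
Qed.

(** * The differences rho(g) - chi2(g) *)

Section Differences.
Variables (T : comNzRingType) (K : comUnitRingType) (iota : {rmorphism T -> K}).
Variables (I : set T) (G : groupType) (rho : G -> 'M[K]_2) (chi1 chi2 : G -> T).
Variables (tau del : G -> T).
Hypotheses (idI : is_ideal I) (iota_inj : injective iota).
Hypothesis rhoM : forall g h, rho (g * h)%g = rho g *m rho h.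
Hypothesis chi1M : forall g h, chi1 (g * h)%g = chi1 g * chi1 h.
Hypothesis chi2M : forall g h, chi2 (g * h)%g = chi2 g * chi2 h.
Hypothesis tr_rho : forall g, \tr (rho g) = iota (tau g).
Hypothesis det_rho : forall g, \det (rho g) = iota (del g).
Hypothesis Itau : forall g, I (tau g - (chi1 g + chi2 g)).
Hypothesis Idel : forall g, I (del g - chi1 g * chi2 g).

Definition rdiff g : 'M[K]_2 := rho g - (iota (chi2 g))%:M.
Local Notation r := rdiff.

(** [rdet], [rtr] and [rpolar] are the elements of [T] below det r_g, tr r_g and tr(r_g^* r_h); the
    last rests on rho(g)^* rho(h) = det(rho(g)) rho(g^-1 h). *)
Definition rdet g := chi2 g ^+ 2 - tau g * chi2 g + del g.
Definition rtr g := tau g - chi2 g *+ 2.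
Definition rpolar g h := del g * tau (g^-1 * h)%g - chi2 h * tau g
  - chi2 g * tau h + (chi2 g * chi2 h) *+ 2.

Lemma det_rdiff g : \det (r g) = iota (rdet g).
Proof. by rewrite det_sub_scalar tr_rho det_rho /rdet; ring. Qed.

Lemma tr_rdiff g : \tr (r g) = iota (rtr g).
Proof. by rewrite /r raddfB /= mxtrace_scalar tr_rho /rtr; ring. Qed.

Lemma tr_conj2_rho g h : \tr (conj2 (rho g) *m rho h) = iota (del g * tau (g^-1
  * h)%g).
Proof.
rewrite -{1}[h](mulVKg g) rhoM mulmxA conj2_mul mul_scalar_mx linearZ /=.
by rewrite det_rho tr_rho rmorphM.
Qed.

Lemma tr_conj2_rdiff g h : \tr (conj2 (r g) *m r h) = iota (rpolar g h).
Proof. by rewrite tr_conj2_sub_scalar tr_conj2_rho !tr_rho /rpolar; ring. Qed.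

Lemma rdet_ideal g : I (rdet g).
Proof.
have -> : rdet g = (del g - chi1 g * chi2 g) - chi2 g * (tau g - (chi1 g + chi2 g)).
  by rewrite /rdet; ring.
by apply: (idealB idI) => //; apply: (idealM idI).
Qed.

(** Modulo [I] the first term of [rpolar] is chi1(g) chi2(h) + chi2(g) chi1(h), and the remaining
    terms cancel it. *)
Lemma rpolar_ideal g h : I (rpolar g h).
Proof.
have e1 : chi1 h = chi1 g * chi1 (g^-1 * h)%g by rewrite -chi1M mulVKg.
have e2 : chi2 h = chi2 g * chi2 (g^-1 * h)%g by rewrite -chi2M mulVKg.
have -> : rpolar g h =
  (del g - chi1 g * chi2 g) * tau (g^-1 * h)%g
  + chi1 g * chi2 g * (tau (g^-1 * h)%g - (chi1 (g^-1 * h)%g + chi2 (g^-1 * h)%g))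
  - chi2 h * (tau g - (chi1 g + chi2 g)) - chi2 g * (tau h - (chi1 h + chi2 h)).
  by rewrite /rpolar e1 e2; ring.
apply: (idealB idI); last by apply: (idealM idI).
apply: (idealB idI); last by apply: (idealM idI).
by apply: (idealD idI); [apply: (idealMr idI)|apply: (idealM idI)].
Qed.

Lemma rho_sub_chi1 g :
  rho g - (iota (chi1 g))%:M =
  - conj2 (r g) + (iota (tau g - (chi1 g + chi2 g)))%:M.
Proof.
rewrite conj2E tr_rdiff /rtr /r; apply/matrixP => i j; rewrite !mxE.
by case: (i == j); rewrite ?mulr1n ?mulr0n; ring.
Qed.

Local Notation kmat := (restr 'M[K]_2 iota).

Definition prod_span : set kmat := @submodule_span T kmat
  [set x | exists g h, x = (rho g - (iota (chi1 g))%:M) *m r h].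

Variable s : seq G.
Local Notation n := (size s).
Definition rgen (k : nat) : kmat := r (nth 1%g s k).
Local Notation comb := (lincomb (fun k : 'I_n => rgen k)).
Variable c : G -> 'rV[T]_n.
Hypothesis cE : forall g, r g = comb (c g).

(** By [rho_sub_chi1] a generator is -r_g^* r_h plus a scalar from [I] times r_h; the latter goes
    into [e]. *)
Lemma prod_span_form x : prod_span x -> exists (sg : 'I_n -> 'I_n -> T) (e :
  'rV[T]_n),
  (forall k, I (e 0 k)) /\
  x = \sum_k \sum_l sg k l *: (conj2 (rgen k) *m rgen l : kmat) + comb e.
Proof.
move: x; pose S : set kmat := [set x | exists (sg : 'I_n -> 'I_n -> T) (e : 'rV[T]_n),
  (forall k, I (e 0 k)) /\
  x = \sum_k \sum_l sg k l *: (conj2 (rgen k) *m rgen l : kmat) + comb e].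
rewrite -[forall x, _]/(prod_span `<=` S); apply: (@span_min T kmat _ S).
  split.
  - exists (fun _ _ => 0), 0; split=> [k|]; first by rewrite mxE;
      exact: (ideal0 idI).
    rewrite linear0 addr0 big1 // => k _; rewrite big1 // => l _;
      exact: scale0r.
  - move=> _ _ [sg [e [Ie ->]]] [sg' [e' [Ie' ->]]].
    exists (fun k l => sg k l + sg' k l), (e + e'); split=> [k|].
      by rewrite mxE; apply: (idealD idI).
    rewrite linearD addrACA; congr (_ + _); rewrite -big_split;
      apply: eq_bigr => k _.
    by rewrite -big_split; apply: eq_bigr => l _ /=; rewrite scalerDl.
  - move=> a _ [sg [e [Ie ->]]].
    exists (fun k l => a * sg k l), (a *: e); split=> [k|].
      by rewrite mxE; apply: (idealM idI).
    rewrite linearZ scalerDr; congr (_ + _); rewrite scaler_sumr;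
      apply: eq_bigr => k _.
    by rewrite scaler_sumr; apply: eq_bigr => l _; rewrite scalerA.
move=> _ [g [h ->]].
exists (fun k l => - (c g 0 k * c h 0 l)), ((tau g - (chi1 g + chi2 g)) *: c h).
split=> [k|]; first by rewrite mxE; apply: (idealMr idI).
rewrite rho_sub_chi1 mulmxDl mul_scalar_mx linearZ /= -cE; congr (_ + _).
have cg : conj2 (r g) = \sum_k iota (c g 0 k) *: conj2 (rgen k).
  have -> : conj2 (r g) = conj2 (\sum_k iota (c g 0 k) *: (rgen k : 'M[K]_2)).
    by congr conj2; exact: cE.
  elim/big_rec2: _ => [|k x y _ <-]; last by rewrite conj2D conj2Z.
  by rewrite -[0 in LHS](scale0r 0) conj2Z scale0r.
have ch : r h = \sum_l iota (c h 0 l) *: (rgen l : 'M[K]_2) by exact: cE.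
rewrite cg ch mulNmx mulmx_suml -sumrN; apply: eq_bigr => k _.
rewrite mulmx_sumr -sumrN; apply: eq_bigr => l _.
rewrite restrZ rmorphN rmorphM scaleNr -scalemxAl -scalemxAr scalerA //.
Qed.

(** Subtracting from the rows of [B] the vectors [e i], which have entries in [I], makes the
    relations exact and changes the determinant only modulo [I]. *)
Lemma rel_det (B : 'M[T]_n) : (forall i, prod_span (comb (row i B))) ->
  exists d, I (d - \det B) /\
    forall j, (j < n)%N -> exists a : K, a%:M = iota d *: (rgen j : 'M[K]_2).
Proof.
move=> hB.
have /choice [sg /choice [e he]] := fun i => prod_span_form (hB i).
have [||||||||d [Id hd]] := @relation_det_scalar T K I iota n (fun k => rgen k
  : 'M[K]_2)
  (fun k => rdet (nth 1%g s k)) (fun k => rtr (nth 1%g s k))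
  (fun k l => rpolar (nth 1%g s k) (nth 1%g s l))
  (fun i k => B i k - e i 0 k) sg.
- exact: idI.
- exact: iota_inj.
- by move=> k; apply: rdet_ideal.
- by move=> k l; apply: rpolar_ideal.
- by move=> k; apply: det_rdiff.
- by move=> k; apply: tr_rdiff.
- by move=> k l; apply: tr_conj2_rdiff.
- move=> i; have [_ hi] := he i.
  have : comb (row i B - e i) = \sum_k \sum_l sg i k l *: (conj2 (rgen k) *m
    rgen l : kmat).
    by rewrite linearB /= hi addrK.
  move=> E; rewrite -[RHS]E; apply: eq_bigr => k _.
  by rewrite restrZ !mxE.
exists d; split=> //.
have -> : d - \det B = (d - \det (\matrix_(i, k) (B i k - e i 0 k))) +
    (\det (\matrix_(i, k) (B i k - e i 0 k)) - \det B) by ring.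
apply: (idealD idI) => //; apply: (det_congr idI) => i j.
rewrite mxE; have -> : B i j - e i 0 j - B i j = - e i 0 j by ring.
by apply: (idealN idI); have [] := he i.
Qed.
End Differences.

(** Cramer's rule, by multiplication with the adjugate of [B]. *)
Lemma det_kills (T : comNzRingType) (V : lmodType T) n (v : 'I_n -> V) (B : 'M[T]_n) :
  (forall i, lincomb v (row i B) = 0) -> forall k, \det B *: v k = 0.
Proof.
move=> h k; have : lincomb v (row k (\adj B *m B)) = 0.
  rewrite row_mul mulmx_sum_row linear_sum big1 // => i _.
  by rewrite linearZ /= h scaler0.
rewrite mul_adj_mx.
have -> : row k (\det B)%:M = \det B *: delta_mx 0 k.
  by apply/rowP => j; rewrite !mxE eqxx eq_sym mulr_natr.
by rewrite linearZ /= lincomb_delta.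
Qed.

Lemma map_conj2 (R S : comNzRingType) (f : {rmorphism R -> S}) (a : 'M[R]_2) :
  map_mx f (conj2 a) = conj2 (map_mx f a).
Proof. by rewrite !conj2E map_mxB map_scalar_mx trace_map_mx. Qed.

(** * Vanishing by irreducibility in the field factors *)

Section FieldFactorVanishing.
Variables (T K : comUnitRingType) (iota : {rmorphism T -> K}).
Hypotheses (T_noeth : noetherian T) (T_red : reduced T).
Hypothesis K_frac : total_ring_of_fractions iota.
Variables (G : groupType) (rho : G -> 'M[K]_2).
Hypothesis rho_irr : forall (k : fieldType) (pi : {rmorphism K -> k}),
  field_factor pi -> irreducible_rep (fun g => map_mx pi (rho g)).

Lemma frac_nonzero (d : T) : d <> 0 -> exists (k : fieldType) (pi : {rmorphism
  K -> k}),
  field_factor pi /\ pi (iota d) != 0.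
Proof.
move=> d0; apply: (exists_field_factor T_noeth T_red K_frac).
apply/eqP => h; apply: d0; case: K_frac => inj _ _; apply: inj.
by rewrite h rmorph0.
Qed.

Lemma scalar_zero (d : T) :
  (forall g, exists a, a%:M = iota d *: rho g) -> d = 0.
Proof.
move=> h; apply: contrapT => /frac_nonzero [k [pi [ff pid]]].
apply: (irreducible_nonscalar (rho_irr ff)) => g; have [a ha] := h g.
exists (pi a / pi (iota d)).
have := congr1 (map_mx pi) ha; rewrite map_scalar_mx map_mxZ => E.
by rewrite mulrC -scale_scalar_mx E scalerA mulVf // scale1r.
Qed.

(** In a field factor where [d] survives, irreducibility makes the image of [q] zero, although its
    trace is a unit. *)
Lemma sandwich_zero (d : T) (q : 'M[K]_2) (t : T) : \det q = 0 ->
  \tr q = iota t -> t \is a GRing.unit ->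
  (forall g, iota d *: sandwich q (rho g) = 0) -> d = 0.
Proof.
move=> dq tq ut h; apply: contrapT => /frac_nonzero [k [pi [ff pid]]].
have q0 : map_mx pi q = 0.
  apply: (irreducible_sandwich (rho_irr ff));
    first by rewrite det_map_mx dq rmorph0.
  move=> g; have := congr1 (map_mx pi) (h g).
  rewrite map_mxZ map_mx0 /sandwich !map_mxM map_conj2 => /eqP.
  by rewrite scaler_eq0 (negPf pid) => /eqP.
have : pi (iota t) = 0 by rewrite -tq -trace_map_mx q0 mxtrace0.
apply/eqP; rewrite -unitfE; do 2!apply: rmorph_unit; exact: ut.
Qed.
End FieldFactorVanishing.

(** * Determinants of relations lie in the ideal *)

Section DetIdeal.
Variables (T : comUnitRingType) (K : comUnitRingType) (iota : {rmorphism T -> K}).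
Hypotheses (T_noeth : noetherian T) (T_red : reduced T).
Hypothesis K_frac : total_ring_of_fractions iota.
Variables (I : set T) (G : groupType) (rho : G -> 'M[K]_2) (chi1 chi2 : G -> T).
Variables (tau del : G -> T).
Hypothesis (idI : is_ideal I).
Hypothesis rhoM : forall g h, rho (g * h)%g = rho g *m rho h.
Hypothesis rho_irr : forall (k : fieldType) (pi : {rmorphism K -> k}),
  field_factor pi -> irreducible_rep (fun g => map_mx pi (rho g)).
Hypothesis chi1M : forall g h, chi1 (g * h)%g = chi1 g * chi1 h.
Hypothesis chi2M : forall g h, chi2 (g * h)%g = chi2 g * chi2 h.
Hypothesis tr_rho : forall g, \tr (rho g) = iota (tau g).
Hypothesis det_rho : forall g, \det (rho g) = iota (del g).
Hypothesis Itau : forall g, I (tau g - (chi1 g + chi2 g)).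
Hypothesis Idel : forall g, I (del g - chi1 g * chi2 g).
Local Notation r := (rdiff iota rho chi2).
Local Notation kmat := (restr 'M[K]_2 iota).
Local Notation Q := (@prod_span T K iota G rho chi1 chi2).
Variable s : seq G.
Local Notation n := (size s).
Local Notation rgen := (@rgen T K iota G rho chi2 s).
Local Notation comb := (lincomb (fun k : 'I_n => rgen k)).
Variable c : G -> 'rV[T]_n.
Hypothesis cE : forall g, r g = comb (c g).

(** The element [d] of [rel_det] makes every generator scalar, hence every rho(g), so it is zero;
    and it is congruent to [\det B]. *)
Lemma rel_det_ideal (B : 'M[T]_n) : (forall i, Q (comb (row i B))) -> I (\det B).
Proof.
move=> hB; have inj : injective iota by case: K_frac.
have [d [Id hd]] := rel_det idI inj rhoM chi1M chi2M tr_rho det_rho Itau Idel cE hB.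
suff d0 : d = 0 by rewrite -[\det B]opprK; apply: (idealN idI);
  rewrite -sub0r -d0.
apply: (scalar_zero T_noeth T_red K_frac rho_irr) => g.
have /choice [a ha] : forall k : 'I_n, exists a : K, a%:M = iota d *: (rgen k :
  'M[K]_2).
  by move=> k; apply: hd.
exists (\sum_k iota (c g 0 k) * a k + iota d * iota (chi2 g)).
have -> : rho g = r g + (iota (chi2 g))%:M by rewrite /rdiff subrK.
rewrite scalerDr raddfD /= scale_scalar_mx; congr (_ + _).
have -> : r g = \sum_k iota (c g 0 k) *: (rgen k : 'M[K]_2) by exact: cE.
rewrite scaler_sumr raddf_sum; apply: eq_bigr => k _.
by rewrite /= -scale_scalar_mx ha !scalerA mulrC.
Qed.

(** [Z] consists of the elements with the same sandwich as some combination with coefficients in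
    [I]. It contains [Q], by [sandwich_conj2] and the unit trace, and r_(s0), whose sandwich is
    zero. So the rows of [B], corrected by [I], are linear equations between the sandwiched
    generators; their determinant kills these, and irreducibility makes it zero. *)
Lemma sandwich_det_ideal s0 l t0 (B : 'M[T]_n) : I l ->
  \det (r s0 - (iota l)%:M) = 0 -> \tr (r s0 - (iota l)%:M) = iota t0 ->
  t0 \is a GRing.unit ->
  (forall i, exists t, Q (comb (row i B) - t *: (r s0 : kmat))) -> I (\det B).
Proof.
set q := r s0 - _ => Il dq tq ut hB.
pose gq g := rpolar chi2 tau del s0 g - l * rtr chi2 tau g.
have gqE g : \tr (conj2 q *m r g) = iota (gq g).
  rewrite /q -scaleN1r conj2D conj2Z conj2_scalar mulmxDl -scalemxAl raddfD /=
    linearZ /=.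
  rewrite mul_scalar_mx linearZ /= (tr_conj2_rdiff _ rhoM tr_rho det_rho)
    (tr_rdiff _ tr_rho).
  by rewrite /gq; ring.
have Igq g : I (gq g).
  apply: (idealB idI); last exact: (idealMr idI).
  exact: (rpolar_ideal idI chi1M chi2M Itau Idel).
have sE g : sandwich q (r g) = sandwich q (comb (c g)) by rewrite -cE.
pose sand : {linear kmat -> kmat} :=
  @restr_map T K iota _ _ (sandwich q : {linear 'M[K]_2 -> 'M[K]_2}).
pose Z : set kmat := [set x | exists e : 'rV[T]_n, (forall k, I (e 0 k)) /\
   sand x = sand (comb e)].
have hZ : is_submodule Z.
  split.
  - by exists 0; split=> [k|]; [rewrite mxE;
      exact: (ideal0 idI)|rewrite !linear0].
  - move=> x y [e [Ie ex]] [e' [Ie' ey]]; exists (e + e'); split=> [k|].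
      by rewrite mxE; apply: (idealD idI).
    by rewrite !linearD ex ey.
  - move=> a x [e [Ie ex]]; exists (a *: e); split=> [k|].
      by rewrite mxE; apply: (idealM idI).
    by rewrite !linearZ /= ex.
have QZ : Q `<=` Z.
  apply: (@span_min T kmat _ Z) => // _ [g [h ->]].
  (* The first term is [sandwich_conj2] divided by the trace [t0] of [q]; the second is the error
     term of [rho_sub_chi1]. *)
  exists (- (t0^-1 *: (gq g *: c h - gq h *: c g)) + (tau g - (chi1 g + chi2
    g)) *: c h).
  split=> [k|].
    rewrite !mxE; apply: (idealD idI); last exact: (idealMr idI).
    apply/(idealN idI)/(idealM idI)/(idealD idI); first exact: (idealMr idI).
    by apply/(idealN idI)/(idealMr idI).
  rewrite (rho_sub_chi1 chi1 chi2 tr_rho) mulmxDl mulNmx mul_scalar_mx.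
  have L (u v : 'M[K]_2) a : sandwich q (- u + a *: v) = - sandwich q u + a *:
    sandwich q v.
    by rewrite linearD linearN linearZ.
  have R (u v : 'rV[T]_n) a b d e : sand (comb (- (d *: (a *: u - b *: v)) + e
    *: u)) =
      - (d *: (a *: sand (comb u) - b *: sand (comb v))) + e *: sand (comb u).
    by rewrite !(linearD, linearN, linearZ).
  rewrite R -!cE [LHS]L.
  have := sandwich_conj2 dq (r g) (r h); rewrite !gqE tq => E.
  have ut' : iota t0 \is a GRing.unit by apply: rmorph_unit.
  have {}E : sandwich q (conj2 (r g) *m r h) =
      iota t0^-1 *: (iota (gq g) *: sandwich q (r h) - iota (gq h) *: sandwich
        q (r g)).
    by rewrite -E scalerA -rmorphM mulVr // rmorph1 scale1r.
  by rewrite E.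
have Zs0 : Z (r s0).
  exists 0; split=> [k|]; first by rewrite mxE; exact: (ideal0 idI).
  rewrite !linear0 -[r s0](subrK (iota l)%:M) -/q; exact: sandwich_shift.
have /choice [e he] : forall i, Z (comb (row i B)).
  move=> i; have [t ht] := hB i; rewrite -(subrK (t *: (r s0 : kmat)) (comb _)).
  by apply: (subD hZ); [apply: QZ|apply: (subZ _ hZ)].
pose B' : 'M[T]_n := \matrix_(i, k) (B i k - e i 0 k).
suff d0 : \det B' = 0.
  have -> : \det B = - (\det B' - \det B) by rewrite d0; ring.
  apply: (idealN idI); apply: (det_congr idI) => i k; rewrite mxE.
  have -> : B i k - e i 0 k - B i k = - e i 0 k by ring.
  by apply: (idealN idI); have [] := he i.
have kills := @det_kills T kmat n (fun k => sand (rgen k)) B'.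
apply: (sandwich_zero T_noeth T_red K_frac rho_irr dq tq ut) => g.
have -> : rho g = r g + (iota (chi2 g))%:M by rewrite /rdiff subrK.
rewrite linearD scalerDr /= -[X in _ + X]/(iota (\det B') *: sandwich q _).
have -> : sandwich q (iota (chi2 g))%:M = 0.
  by rewrite /sandwich mul_mx_scalar -scalemxAl mul_conj2 dq raddf0 scaler0.
rewrite scaler0 addr0 sE -[LHS]/(\det B' *: sand (comb (c g))) /lincomb.
rewrite linear_sum scaler_sumr big1 // => k _.
rewrite linearZ /= scalerA mulrC -scalerA kills ?scaler0 // => i.
have [_ ei] := he i.
have -> : row i B' = row i B - e i by apply/rowP => j; rewrite !mxE.
have -> : forall v, lincomb (fun k : 'I_n => sand (rgen k)) v = sand (comb v).
  by move=> v; rewrite /lincomb linear_sum; apply: eq_bigr => j _;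
    rewrite linearZ.
by rewrite !linearB /= ei subrr.
Qed.
End DetIdeal.

Section MapIota.
Variables (T K : comNzRingType) (iota : {rmorphism T -> K}).
Definition map_restr p q (w : 'M[T]_(p, q)) : restr 'M[K]_(p, q) iota := map_mx
  iota w.
Lemma map_restr_linear p q : linear (@map_restr p q).
Proof.
by move=> a x y; rewrite /map_restr map_mxD map_mxZ.
Qed.
HB.instance Definition _ p q := GRing.isLinear.Build T 'M[T]_(p, q)
  (restr 'M[K]_(p, q) iota) _ (@map_restr p q) (@map_restr_linear p q).
End MapIota.

(** * Continuity and surjectivity *)

Section Topological.
Variables (T : comUnitRingType) (m : set T).
Hypotheses (T_noeth : noetherian T) (idm : is_ideal m).
Variables (G : topologicalGroupType) (G_compact : compact [set: G]).
Variables (K : comUnitRingType) (iota : {rmorphism T -> K}).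
Variables (rho : G -> 'M[K]_2) (chi2 : G -> T).
Hypothesis rho_rep : continuous_representation m iota rho.
Hypothesis chi2_cont : filtration_continuous (ideal_pow m) chi2.
Hypothesis chi21 : chi2 1%g = 1.
Local Notation r := (rdiff iota rho chi2).
Local Notation kmat := (restr 'M[K]_2 iota).

Lemma rho_near N g : nbhs g [set h | exists2 w : 'M[T]_2,
  rho h - rho g = map_mx iota w & forall i j, ideal_pow m N (w i j)].
Proof.
have h i j : nbhs g [set h | (iota @` ideal_pow m N) (rho h i j - rho g i j)].
  have H := proj2 rho_rep i j g.
  by apply: (H [set y | (iota @` ideal_pow m N) (y - rho g i j)]); exists N.
have : nbhs g (([set h | (iota @` ideal_pow m N) (rho h 0 0 - rho g 0 0)] `&`
  [set h | (iota @` ideal_pow m N) (rho h 0 1 - rho g 0 1)]) `&`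
  ([set h | (iota @` ideal_pow m N) (rho h 1 0 - rho g 1 0)] `&`
  [set h | (iota @` ideal_pow m N) (rho h 1 1 - rho g 1 1)])).
  by do !apply: filterI.
apply: filterS => u [[h00 h01] [h10 h11]].
have /choice [w hw] : forall ij : 'I_2 * 'I_2, exists t, ideal_pow m N t /\
    iota t = rho u ij.1 ij.2 - rho g ij.1 ij.2.
  case=> i j; case: (ord2P i) => ->; case: (ord2P j) => -> /=;
  by [case: h00 => t ? ?; exists t|case: h01 => t ? ?; exists t
     |case: h10 => t ? ?; exists t|case: h11 => t ? ?; exists t].
exists (\matrix_(i, j) w (i, j)).
  by apply/matrixP => i j; rewrite !mxE (proj2 (hw (i, j))).
by move=> i j; rewrite mxE; have [] := hw (i, j).
Qed.

Lemma rdiff_near1 N : nbhs (1%g : G) [set h | exists2 w : 'M[T]_2,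
  r h = map_mx iota w & forall i j, ideal_pow m N (w i j)].
Proof.
have h2 : nbhs (1%g : G) [set h | ideal_pow m N (chi2 h - chi2 1%g)].
  have H := chi2_cont (x := 1%g).
  by apply: (H [set y | ideal_pow m N (y - chi2 1%g)]); exists N.
apply: filterS (filterI (rho_near N 1%g) h2) => u [[w hw wN]];
  rewrite chi21 /= => uN.
exists (w - (chi2 u - 1)%:M).
  rewrite map_mxB map_scalar_mx -hw rmorphB rmorph1 raddfB /=.
  have [[_ -> _] _] := rho_rep; rewrite /rdiff; apply/matrixP => i j;
    rewrite !mxE; ring.
move=> i j; rewrite !mxE; apply: (idealB (ideal_pow_ideal m N)) => //.
by case: (i == j); rewrite ?mulr1n // mulr0n;
  apply: (ideal0 (ideal_pow_ideal m N)).
Qed.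

(** On the open set [U h] the map rho differs from rho(h) by matrices over [T]. Finitely many such
    sets cover [G], so all r_g lie in one finitely generated module, and their span is generated by
    finitely many of them. *)
Lemma rdiff_generators : exists (s : seq G) (c : G -> 'rV[T]_(size s)),
  forall g, r g = lincomb (fun k : 'I_(size s) => @rgen T K iota G rho chi2 s
    k) (c g).
Proof.
pose U g : set G := [set h | exists w : 'M[T]_2, rho h - rho g = map_mx iota w].
have oU g : open (U g).
  rewrite openE => h [w hw]; have := rho_near 0 h;
    apply: filterS => u [w' hw' _].
  by exists (w' + w); rewrite map_mxD -hw -hw' addrA subrK.
have [l hl] : exists l : seq G, forall g, exists2 h, h \in l & U h g.
  (* The filter of finite lists under inclusion extracts a finite subcover from the near-covering
     form of compactness. *)
  pose F : set_system (seq G) :=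
    [set A : set (seq G) | exists l0 : seq G, forall l : seq G, {subset l0 <=
      l} -> A l].
  have FF : Filter F.
    split; first by exists [::].
      move=> A B [l hA] [l' hB]; exists (l ++ l') => k kl.
      by split; [apply: hA|apply: hB] => x xl; apply: kl;
        rewrite mem_cat xl ?orbT.
    by move=> A B AB [l hA]; exists l => k /hA/AB.
  have /compact_near_coveringP nc := G_compact.
  have [|l hl] := nc _ F (fun l g => exists2 h, h \in l & U h g) FF; last first.
    by exists l => g; apply: hl.
  move=> g _; exists (U g, [set l : seq G | g \in l]); last first.
    by move=> [x l] [/= Ux gl]; exists g.
  split; last by exists [:: g] => l h; apply: h; rewrite inE.
  by move: (oU g); rewrite openE; apply; exists 0; rewrite subrr map_mx0.
pose f (x : 'rV[T]_(size l) * 'M[T]_2) : kmat :=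
  lincomb (fun k : 'I_(size l) => (r (nth 1%g l k) : kmat)) x.1 + map_restr iota x.2.
have fL : linear f.
  move=> a x y; rewrite /f [(_ + _).1]/= [(_ + _).2]/=.
  by rewrite !linearP scalerDr addrACA.
pose F : {linear _ -> _} := HB.pack f (GRing.isLinear.Build _ _ _ _ f fL).
have [t tX tE] : exists2 t : seq kmat, [set` t] `<=` range (r : G -> kmat) &
    submodule_span [set` t] = submodule_span (range (r : G -> kmat)).
  apply: fg_span_sub.
  apply: (@noeth_range T _ _ F); first by apply: noeth_prod;
    exact: noeth_matrix.
    exact: span_submodule.
  apply: span_min; first by apply: image_submodule; exact: is_submoduleT.
  move=> _ [g _ <-]; have [gi gil [w hw]] := hl g.
  have gl : (index gi l < size l)%N by rewrite index_mem.
  exists (delta_mx 0 (Ordinal gl), w - (chi2 g - chi2 gi)%:M) => //.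
  rewrite /F /= /f /= lincomb_delta /= nth_index // /map_restr.
  rewrite map_mxB map_scalar_mx -hw rmorphB raddfB /= /rdiff.
  by apply/matrixP => i j; rewrite !mxE; ring.
have [s ts] : exists s : seq G, t = map r s.
  elim: t tX {tE} => [|x t IH] tX; first by exists [::].
  have [|s ->] := IH; first by move=> y yt; apply: tX; rewrite /= inE yt orbT.
  have [|g _ <-] := tX x; first by rewrite /= inE eqxx.
  by exists (g :: s).
exists s.
have /choice [c hc] : forall g, exists v : 'rV[T]_(size s),
    r g = lincomb (fun k : 'I_(size s) => @rgen T K iota G rho chi2 s k) v.
  move=> g; have : submodule_span [set` t] (r g : kmat).
    by rewrite tE; apply: sub_span; exists g.
  rewrite span_seqP ts => -[v ->].
  exists (\row_k v k); rewrite size_map; apply: eq_bigr => k _.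
  by rewrite mxE (nth_map 1%g).
by exists c.
Qed.

Section Kappa.
Variables (s : seq G).
Local Notation n := (size s).
Local Notation comb := (lincomb (fun k : 'I_n => @rgen T K iota G rho chi2 s k)).
Variable c : G -> 'rV[T]_n.
Hypothesis cE : forall g, r g = comb (c g).
Variables (M : lmodType T) (p : {linear 'rV[T]_n -> M}).
Hypothesis p_ker : forall v, comb v = 0 -> p v = 0.

(** Near 1 the matrix r_u has entries in a high power of [m]. The weak Artin-Rees lemma rewrites it
    with small coefficients on the generators, and by [p_ker] these may replace [c u]. *)
Lemma kappa_near1 e : nbhs (1%g : G) [set u | adic m e (p (c u))].
Proof.
pose P : set 'M[T]_2 := [set w | exists v, map_restr iota w = comb v].
pose L : set 'M[T]_2 := [set w | exists2 v : 'rV[T]_n, (forall k, ideal_pow m e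
  (v 0 k)) &
   map_restr iota w = comb v].
have hP : is_submodule P.
  split; first by exists 0; rewrite !linear0.
    by move=> x y [v hv] [v' hv']; exists (v + v'); rewrite !linearD /= hv hv'.
  by move=> a x [v hv]; exists (a *: v); rewrite !linearZ /= hv.
have ide := ideal_pow_ideal m e.
have hL : is_submodule L.
  split; first by exists 0; rewrite ?linear0 // => k; rewrite mxE;
    exact: (ideal0 ide).
    move=> x y [v Iv hv] [v' Iv' hv']; exists (v + v') => [k|].
      by rewrite mxE; apply: (idealD ide).
    by rewrite !linearD /= hv hv'.
  move=> a x [v Iv hv]; exists (a *: v) => [k|]; last by rewrite !linearZ /= hv.
  by rewrite mxE; apply: (idealM ide).
have [||N hN] := weak_artin_rees T_noeth idm (n := e) (noeth_matrix T_noeth (n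
  := 2)) hP hL.
- by move=> w [v _ hv]; exists v.
- move=> a w Ia [v hv]; exists (a *: v) => [k|]; last by rewrite !linearZ /= hv.
  by rewrite mxE; apply: (idealMr ide).
have := rdiff_near1 N; apply: filterS => u [w hw wN].
have Pw : P w by exists (c u); rewrite -cE hw.
have aw : adic m N w by apply/adic_matrix.
have [v Iv hv] := hN w aw Pw.
rewrite /=; suff -> : p (c u) = p v.
  by apply: adic_linear; apply/adic_matrix => i k; rewrite ord1.
apply/eqP; rewrite -subr_eq0 -linearB; apply/eqP/p_ker.
by rewrite linearB /= -hv -cE hw subrr.
Qed.
End Kappa.

(** Since kappa(y) - kappa(x) = chi(x) kappa(x^-1 y), smallness near 1 is enough. *)
Lemma cocycle_continuous (M : lmodType T) (chi : G -> T) (kappa : G -> M) :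
  (forall s t, kappa (s * t)%g = kappa s + chi s *: kappa t) ->
  (forall e, nbhs (1%g : G) [set u | adic m e (kappa u)]) ->
  filtration_continuous (@adic T m M) kappa.
Proof.
move=> hk h1 x A [e eA].
have cx : (fun y => (x^-1 * y)%g) @ x --> (x^-1 * x)%g.
  have -> : (fun y => (x^-1 * y)%g) = (fun xy : G * G => (xy.1 * xy.2)%g) \o
    (fun y => (x^-1%g, y)) by [].
  apply: (@cvg_comp _ _ _ (fun y : G => (x^-1%g, y)) (fun xy : G * G => (xy.1 *
    xy.2)%g) _ (nbhs (x^-1%g, x))).
    by apply: cvg_pair => //; exact: cvg_cst.
  exact: (mulg_continuous (s := G) (x^-1%g, x)).
rewrite mulVg in cx; rewrite -[_ A]/(nbhs x (kappa @^-1` A)).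
have H : nbhs x [set y | adic m e (kappa (x^-1 * y)%g)] := cx _ (h1 e).
apply: filterS H => y /= hy; apply: eA => /=.
rewrite -{1}[y](mulVKg x) hk addrAC subrr add0r.
exact: (subZ _ (@adic_submodule T m M e) hy).
Qed.
End Topological.

Section Surjective.
Variables (T : comUnitRingType) (m : set T).
Hypotheses (T_local : local_ring m) (T_noeth : noetherian T).
Variables (G : topologicalGroupType) (chi : G -> T) (M : lmodType T).
Variable kappa : G -> M.
Hypothesis hM : noeth_mod M.
Hypothesis kappa_span : submodule_span (range kappa) = setT.

Definition coh_class : set (G -> M) :=
  [set kappa' | cocycle m chi kappa' /\ coboundary chi (fun s => kappa' s - kappa s)].

(** Coboundaries take their values in m M, so Nakayama's lemma applies to the span of [k']. *)
Lemma surjective_residually_trivial :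
  (forall s, m (chi s - 1)) -> surjective_class coh_class.
Proof.
move=> chi1 k' [_ [x hx]]; have idm := local_ideal T_local.
apply: (nakayama T_local T_noeth hM (span_submodule _)) => y.
have : submodule_span (range kappa) y by rewrite kappa_span.
move: y; apply: (@span_min T M (range kappa) (sum_sub (submodule_span (range
  k')) (smul m setT))).
  by apply: sum_sub_submodule; [exact: span_submodule|exact: smul_submodule].
move=> _ [s _ <-]; exists (k' s); first by apply: sub_span; exists s.
rewrite -opprB hx; apply: (subN (smul_submodule _ _)).
exact: smulP.
Qed.

(** The value [k' s0] is a unit multiple of the vector [x] of the coboundary; so the span contains
    [x], and with it all values of [kappa]. *)
Lemma surjective_residually_distinct s0 : chi s0 - 1 \is a GRing.unit ->
  kappa s0 = 0 -> surjective_class coh_class.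
Proof.
move=> us0 ks0 k' [_ [x hx]].
have hS := span_submodule (range k').
have Sk s : submodule_span (range k') (k' s) by apply: sub_span; exists s.
have Sx : submodule_span (range k') x.
  have := hx s0; rewrite ks0 subr0 => e.
  have -> : x = (chi s0 - 1)^-1 *: k' s0 by rewrite e scalerA mulVr // scale1r.
  exact: (subZ _ hS).
apply/seteqP; split=> // y _.
have : submodule_span (range kappa) y by rewrite kappa_span.
move: y; apply: (@span_min T M (range kappa)) => // _ [s _ <-].
have -> : kappa s = k' s - (chi s - 1) *: x by rewrite -hx opprB addrC subrK.
by apply: (subB hS) => //; apply: (subZ _ hS).
Qed.
End Surjective.

(** * The module T^n / N, its cocycle and its Fitting ideal *)

Theorem theorem1p3 (T : comUnitRingType) (m : set T)
    (T_local : local_ring m) (T_noetherian : noetherian T)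
    (T_reduced : reduced T) (T_complete : adically_complete m)
    (G : topologicalGroupType) (G_compact : compact [set: G])
    (K : comUnitRingType) (iota : {rmorphism T -> K})
    (K_frac : total_ring_of_fractions iota)
    (rho : G -> 'M[K]_2) (rho_rep : continuous_representation m iota rho)
    (rho_irr : forall (k : fieldType) (pi : {rmorphism K -> k}),
       field_factor pi -> irreducible_rep (fun g => map_mx pi (rho g)))
    (I : set T) (I_proper : is_proper_ideal I)
    (chi1 chi2 : G -> T)
    (chi1_char : adic_character m chi1) (chi2_char : adic_character m chi2)
    (rho_congr : forall g : G,
       poly_congr iota I (char_poly (rho g))
         (('X - (chi1 g)%:P) * ('X - (chi2 g)%:P))) :
  exists (M : lmodType T) (kappa : set (G -> M)),
    [/\ finitely_generated [set: M],
        H1 m (fun g => (chi2 g)^-1 * chi1 g) kappa,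
        surjective_class kappa
      & Fitt M `<=` I].
Proof.
have idm := local_ideal T_local.
have idI : is_ideal I by case: I_proper.
have Im : I `<=` m.
  apply: (proper_sub_local T_local T_noetherian idI) => I1.
  case: I_proper => _; apply; apply/seteqP; split=> // x _.
  by rewrite -[x]mulr1; apply: (idealM idI).
have inj : injective iota by case: K_frac.
have [_ _ rhoM] : is_representation rho by case: rho_rep.
have [chi1u _ chi1M _] := chi1_char.
have [chi2u chi21 chi2M chi2c] := chi2_char.
have /choice [td htd] := fun g => char_congr_coef (rho_congr g) idI.
pose tau g := (td g).1; pose del g := (td g).2.
have tr_rho g : \tr (rho g) = iota (tau g) by case: (htd g).
have det_rho g : \det (rho g) = iota (del g) by case: (htd g).
have Itau g : I (tau g - (chi1 g + chi2 g)) by case: (htd g).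
have Idel g : I (del g - chi1 g * chi2 g) by case: (htd g).
have [s [c cE]] := rdiff_generators T_noetherian G_compact chi2 rho_rep.
set n := size s in c cE *.
pose comb : {linear 'rV[T]_n -> restr 'M[K]_2 iota} :=
  lincomb (fun k : 'I_n => @rgen T K iota G rho chi2 s k).
have cE' g : (rdiff iota rho chi2 g : restr 'M[K]_2 iota) = comb (c g) := cE g.
pose Q := @prod_span T K iota G rho chi1 chi2.
pose chi g := (chi2 g)^-1 * chi1 g.
(* Both cases take [M] to be T^n / N; they differ in [N] and in the reason for surjectivity. *)
have main (N : set 'rV[T]_n) : is_submodule N ->
    (forall v, Q (comb v) -> N v) ->
    (forall B : 'M[T]_n, (forall i, N (row i B)) -> I (\det B)) ->
    (forall (M : lmodType T) (p : {linear 'rV[T]_n -> M}) (kappa : G -> M),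
       (forall v, p v = 0 <-> N v) -> (forall g, kappa g = (chi2 g)^-1 *: p (c g)) ->
       noeth_mod M -> submodule_span (range kappa) = setT ->
       surjective_class (coh_class m chi kappa)) ->
    exists (M : lmodType T) (kappa : set (G -> M)),
    [/\ finitely_generated [set: M], H1 m chi kappa, surjective_class kappa
      & Fitt M `<=` I].
  move=> hN QN detN surjN; have [M [p [ps pN]]] := quotient_module hN.
  have hM : noeth_mod M.
    move=> S hS; apply: (noeth_range (f := p)) hS _; first exact: noeth_matrix.
    by move=> y _; have [x <-] := ps y; exists x.
  pose kappa g := (chi2 g)^-1 *: p (c g).
  have p_ker v : comb v = 0 -> p v = 0.
    by move=> v0; apply/pN/QN; rewrite v0; exact: (sub0 (span_submodule _)).
  have kM g h : kappa (g * h)%g = kappa g + chi g *: kappa h.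
    rewrite /kappa /chi scalerA.
    (* This rests on r_(gh) = chi2(h) r_g + chi1(g) r_h + (rho(g) - chi1(g)) r_h, whose last term
       lies in [Q]. *)
    have -> : p (c (g * h)%g) = chi2 h *: p (c g) + chi1 g *: p (c h).
      rewrite -!linearZ -linearD; apply/eqP; rewrite -subr_eq0 -linearB;
        apply/eqP/pN/QN.
      rewrite linearB linearD !linearZ /= -!cE'.
      apply: sub_span; exists g, h; rewrite /rdiff !restrZ rhoM chi2M.
      rewrite mulmxBl !mulmxBr !mul_scalar_mx !mul_mx_scalar rmorphM.
      apply/matrixP => i j; rewrite !mxE.
      by case: (i == j); rewrite ?mulr1n ?mulr0n; ring.
    rewrite scalerDr !scalerA chi2M; congr (_ *: _ + _ *: _).
      by rewrite invrM // mulrAC mulVr // mul1r.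
    by rewrite invrM //; ring.
  have kc : cocycle m chi kappa.
    split=> //; apply: cocycle_continuous kM _ => e.
    have := kappa_near1 T_noetherian idm rho_rep chi2c chi21 cE p_ker e.
    apply: filterS => u /= hu; exact: (subZ _ (@adic_submodule T m M e)).
  have kspan : submodule_span (range kappa) = setT.
    apply/seteqP; split=> // y _; have [v <-] := ps y.
    rewrite (row_sum_delta v) linear_sum; apply: sub_sum => [|k _];
      first exact: span_submodule.
    rewrite linearZ /=; apply: (subZ _ (span_submodule _)).
    (* The [k]-th unit vector and the value of [c] at the [k]-th group element represent the same
       matrix. *)
    have -> : p (delta_mx 0 k) = chi2 (nth 1%g s k) *: kappa (nth 1%g s k).
      rewrite /kappa scalerA divrr // scale1r; apply/eqP;
        rewrite -subr_eq0 -linearB.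
      by apply/eqP/p_ker; rewrite linearB /= -cE' lincomb_delta subrr.
    by apply: (subZ _ (span_submodule _)); apply: sub_span;
      exists (nth 1%g s k).
  exists M, (coh_class m chi kappa); split.
  - exact: hM.
  - by exists kappa.
  - exact: (surjN M p kappa).
  - exact: (Fitt_sub T_noetherian idI ps pN hN).
have [triv|/existsNP [s0 ms0]] := pselect (forall g, m (chi g - 1)).
  apply: (main (comb @^-1` Q)) => //.
  - exact/preimage_submodule/span_submodule.
  - exact: (rel_det_ideal T_noetherian T_reduced K_frac idI rhoM rho_irr chi1M
      chi2M tr_rho det_rho Itau Idel cE).
  - by move=> M p kappa _ _ hM kspan; apply: surjective_residually_trivial.
have us0 : chi s0 - 1 \is a GRing.unit by apply: (nonlocal_unit T_local).
have ut : rtr chi2 tau s0 \is a GRing.unit.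
  (* The trace is chi1(s0) - chi2(s0), a unit by the choice of [s0], plus an element of [I]. *)
  have -> : rtr chi2 tau s0 = chi2 s0 * (chi s0 - 1) - - (tau s0 - (chi1 s0 +
    chi2 s0)).
    rewrite /rtr /chi mulrBr mulrA divrr //; ring.
  apply: (unit_subm T_local T_noetherian); first by rewrite unitrM chi2u.
  by apply/Im/(idealN idI).
(* The polynomial is the characteristic polynomial of r_(s0), so that r_(s0) - l is singular; its
   trace differs from a unit by 2 l and is again a unit. *)
have [l Il hl] := quadratic_root T_local T_noetherian T_complete idI Im ut
  (rdet_ideal idI Itau Idel s0).
(* Adding [c s0] to the relations makes the cocycle vanish at [s0]. *)
pose N : set 'rV[T]_n := [set v | exists t, Q (comb (v - t *: c s0))].
have hQ : is_submodule Q := span_submodule _.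
apply: (main N).
- split.
  + by exists 0; rewrite scale0r subr0 linear0; exact: (sub0 hQ).
  + move=> v w [t ht] [t' ht']; exists (t + t').
    by rewrite scalerDl opprD addrACA linearD; apply: (subD hQ).
  + move=> a v [t ht]; exists (a * t).
    by rewrite -scalerA -scalerBr linearZ; apply: (subZ _ hQ).
- by move=> v Qv; exists 0; rewrite scale0r subr0.
- move=> B hB.
  apply: (sandwich_det_ideal T_noetherian T_reduced K_frac idI rhoM rho_irr
    chi1M chi2M
            tr_rho det_rho Itau Idel cE (s0 := s0) (l := l) (t0 := rtr chi2 tau
              s0 - l *+ 2)) => //.
  + rewrite det_sub_scalar (tr_rdiff _ tr_rho) (det_rdiff _ tr_rho det_rho).
    by rewrite -(rmorph0 iota) -hl; ring.
  + by rewrite raddfB /= mxtrace_scalar (tr_rdiff _ tr_rho); ring.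
  + by apply: (unit_subm T_local T_noetherian) => //; apply: Im;
      rewrite mulr2n; apply: (idealD idI).
  + move=> i; have [t ht] := hB i; exists t.
    by move: ht; rewrite linearB linearZ /= -cE'.
- move=> M p kappa pN kE hM kspan;
    apply: (surjective_residually_distinct kspan us0).
  rewrite kE; have -> : p (c s0) = 0; last by rewrite scaler0.
  by apply/pN; exists 1; rewrite scale1r subrr linear0; exact: (sub0 hQ).
Qed.
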